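(* Let $\mathscr C$ be a $1$-category. Tangent objects in $\mathsf{Bicat}(\mathscr C^{\mathrm{op}},\mathbf{Cat})$ are determined by pseudofunctors $F:\mathscr C^{\mathrm{op}}\to\mathbf{Cat}$ which factor through the forgetful functor $\mathrm{Forget}:\mathfrak{Tan}_{\mathrm{strong}}\to\mathbf{Cat}$, i.e. as $\mathscr C^{\mathrm{op}}\to\mathfrak{Tan}_{\mathrm{strong}}\xrightarrow{\mathrm{Forget}}\mathbf{Cat}$.
   Context: $\mathsf{Bicat}(\mathscr C^{\mathrm{op}},\mathbf{Cat})$ is the $2$-category of (normalized) pseudofunctors, pseudonatural transformations and modifications. Tangent categories. A tangent structure $\mathbb T=(T,p,0,+,\ell,c)$ on a category $\mathscr D$ consists of a functor $T:\mathscr D\to\mathscr D$ and natural transformations $p:T\Rightarrow\mathrm{id}$, $0:\mathrm{id}\Rightarrow T$, $+:T_2\Rightarrow T$, $\ell:T\Rightarrow T^2$, $c:T^2\Rightarrow T^2$ such that: (1) for every object $A$ and $n\in\mathbb N$ the $n$-fold pullback power $T_nA$ of $p_A:TA\to A$ exists and is preserved by all $T^m$; (2) $(p_A,+_A,0_A)$ is a commutative monoid in $\mathscr D_{/A}$; (3) $T(p_A)\ell_A=0_Ap_A$, $\ell_A\circ{+_A}=T(+_A)\circ\langle\ell_A\pi_1,\ell_A\pi_2\rangle$, $\ell_A0_A=T(0_A)0_A$; (4) $p_{TA}c_A=T(p_A)$, $c_A\circ T(+_A)={+_{TA}}\circ\langle c_AT(\pi_1),c_AT(\pi_2)\rangle$,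 $c_AT(0_A)=0_{TA}$; (5) $c_Ac_A=\mathrm{id}$, $c_A\ell_A=\ell_A$, $T(\ell_A)\ell_A=\ell_{TA}\ell_A$, $c_{TA}T(c_A)c_{TA}=T(c_A)c_{TA}T(c_A)$, $c_{TA}T(c_A)\ell_{TA}=T(\ell_A)c_A$; (6) $T(+_A)\circ\langle\ell_A\pi_1,0_{TA}\pi_2\rangle:T_2A\to T^2A$ is an equalizer of $T(p_A)$ and $0_A\,p_A\,p_{TA}:T^2A\rightrightarrows TA$. $\mathfrak{Tan}_{\mathrm{strong}}$: objects tangent categories; $1$-cells $(\mathscr D,\mathbb T)\to(\mathscr E,\mathbb S)$, $\mathbb S=(S,q,0',\oplus,\ell',c')$, are strong tangent morphisms $(H,\alpha)$: a functor $H$ preserving the pullbacks and equalizers of the tangent structure and a natural isomorphism $\alpha:HT\Rightarrow SH$ with $(q H)\alpha=Hp$, $\alpha (H0)=0'H$, $\alpha (H{+})=(\oplus H)\alpha_2$ ($\alpha_2:HT_2\Rightarrow S_2H$ induced by $\alpha$), $(\ell' H)\alpha=(S\alpha)(\alpha T)(H\ell)$, $(c'H)(S\alpha)(\alpha T)=(S\alpha)(\alpha T)(Hc)$; $2$-cells $(H,\alpha)\Rightarrow(K,\beta)$ are natural $\rho:H\Rightarrow K$ with $(S\rho)\alpha=\beta(\rho T)$. $\mathrm{Forget}$ sends a tangent category to its underlying category, $(H,\alpha)$ to $H$ and $\rho$ to $\rho$. Tangent objects (Lanfranchi). A tangent object in a $2$-category $\mathcal K$ is an object $X$ with a $1$-cell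 $T:X\to X$ and $2$-cells $p:T\Rightarrow\mathrm{id}_X$, $0:\mathrm{id}_X\Rightarrow T$, $\mathrm{add}:T_2\Rightarrow T$, $\ell:T\Rightarrow T^2$, $c:T^2\Rightarrow T^2$ satisfying the axioms of a tangent category read in the hom-category $\mathcal K(X,X)$: the pullback powers $T_n$ of $p$ exist, are preserved by post-composition with all $T^m$, and are pointwise (preserved by the precomposition functors $\mathcal K(f,X)$ for all $1$-cells $f:X'\to X$); $(T,\mathrm{add},0)$ is a commutative monoid over $\mathrm{id}_X$; equations (3)–(5) hold with $T(-)$, $(-)_T$ read as whiskerings; and the square formed by $(T\ast\mathrm{add})\langle\ell\pi_1,(0\ast T)\pi_2\rangle:T_2\Rightarrow T^2$, $p\pi_1:T_2\Rightarrow\mathrm{id}_X$, $T\ast p:T^2\Rightarrow T$, $0:\mathrm{id}_X\Rightarrow T$ is a pointwise pullback. (Equivalently, a strong monoidal functor from the category $\mathsf{Weil}_1$ of Weil algebras to $\mathcal K(X,X)$ preserving the fundamental tangent pullbacks pointwise.) *)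

(* Defs.v *)
#[warnings="-notation-overridden"]
From mathcomp Require Import ssreflect ssrfun ssrbool eqtype ssrnat fintype.
From mathcomp Require Import boolp.

Set Implicit Arguments.
Unset Strict Implicit.
Unset Printing Implicit Defensive.
Set Primitive Projections.
#[local] Obligation Tactic := idtac.

Declare Scope cat_scope.
Delimit Scope cat_scope with cat.
Local Open Scope cat_scope.

(* Objects and arrows live in one arbitrary universe; the categories in this
   universe are the objects of [CAT] below. *)
Record Category := {
  Ob :> Type;
  Hom : Ob -> Ob -> Type;
  idm : forall x, Hom x x;
  cmp : forall x y z, Hom y z -> Hom x y -> Hom x z;
  cmp_idl : forall x y (f : Hom x y), cmp (idm y) f = f;
  cmp_idr : forall x y (f : Hom x y), cmp f (idm x) = f;
  cmp_assoc : forall x y z w (h : Hom z w) (g : Hom y z) (f : Hom x y),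
    cmp (cmp h g) f = cmp h (cmp g f) }.

Arguments Hom {_} _ _.
Arguments idm {_} _.
Arguments cmp {_ _ _ _} _ _.

Notation "g ∘ f" := (cmp g f) (at level 60, right associativity) : cat_scope.

Definition is_iso (D : Category) (x y : D) (f : Hom x y) : Prop :=
  exists g : Hom y x, g ∘ f = idm x /\ f ∘ g = idm y.

Definition cell_of_eq (D : Category) (x y : D) (e : x = y) : Hom x y :=
  match e in (_ = z) return Hom x z with erefl => idm x end.

Definition op (C : Category) : Category := {|
  Ob := C;
  Hom := fun x y => @Hom C y x;
  idm := fun x => idm x;
  cmp := fun x y z g f => f ∘ g;
  cmp_idl := fun x y f => cmp_idr f;
  cmp_idr := fun x y f => cmp_idl f;
  cmp_assoc := fun x y z w h g f => esym (cmp_assoc f g h) |}.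

Record Functor (D E : Category) := {
  fobj :> D -> E;
  fmap : forall x y, Hom x y -> Hom (fobj x) (fobj y);
  fmap_id : forall x, fmap (idm x) = idm (fobj x);
  fmap_cmp : forall x y z (g : Hom y z) (f : Hom x y),
    fmap (g ∘ f) = fmap g ∘ fmap f }.

Arguments fmap {_ _} _ {_ _} _.

Record NatTrans (D E : Category) (F G : Functor D E) := {
  ncomp :> forall x, Hom (F x) (G x);
  ncomp_nat : forall x y (f : Hom x y), ncomp y ∘ fmap F f = fmap G f ∘ ncomp x }.

Lemma nat_ext (D E : Category) (F G : Functor D E) (a b : NatTrans F G) :
  (forall x, a x = b x) -> a = b.
Proof.
case: a b => [a na] [b nb] /= ab.
have eab : a = b by apply: functional_extensionality_dep.
by subst b; congr Build_NatTrans; apply: Prop_irrelevance.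
Qed.

Definition fid (D : Category) : Functor D D := {|
  fobj := fun x => x;
  fmap := fun x y f => f;
  fmap_id := fun x => erefl;
  fmap_cmp := fun x y z g f => erefl |}.

Program Definition fcmp (D E K : Category) (G : Functor E K) (F : Functor D E) :
  Functor D K := {|
  fobj := fun x => G (F x);
  fmap := fun x y f => fmap G (fmap F f) |}.
Next Obligation. by move=> * /=; rewrite !fmap_id. Qed.
Next Obligation. by move=> * /=; rewrite !fmap_cmp. Qed.

Program Definition nid (D E : Category) (F : Functor D E) : NatTrans F F :=
  {| ncomp := fun x => idm (F x) |}.
Next Obligation. by move=> * /=; rewrite cmp_idl cmp_idr. Qed.

Program Definition ncmp (D E : Category) (F G H : Functor D E)
  (b : NatTrans G H) (a : NatTrans F G) : NatTrans F H :=
  {| ncomp := fun x => b x ∘ a x |}.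
Next Obligation.
by move=> D E F G H b a x y f /=; rewrite cmp_assoc ncomp_nat -!cmp_assoc ncomp_nat.
Qed.

Program Definition FunCat (D E : Category) : Category := {|
  Ob := Functor D E;
  Hom := @NatTrans D E;
  idm := @nid D E;
  cmp := @ncmp D E |}.
Next Obligation. by move=> *; apply: nat_ext => x /=; rewrite cmp_idl. Qed.
Next Obligation. by move=> *; apply: nat_ext => x /=; rewrite cmp_idr. Qed.
Next Obligation. by move=> *; apply: nat_ext => x /=; rewrite cmp_assoc. Qed.

(* A 2-category is presented as a bicategory: in type theory associativity of
   1-cells is rendered by coherence cells, not by equality of 1-cells.  In
   [CAT], [TAN] and [BICAT] all components of these cells are identities. *)
Record Bicategory := {
  bob :> Type;
  bhom : bob -> bob -> Category;
  bid : forall x, bhom x x;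
  bcmp : forall x y z, bhom y z -> bhom x y -> bhom x z;
  lwhisk : forall x y z (g : bhom y z) (f f' : bhom x y),
    Hom f f' -> Hom (bcmp g f) (bcmp g f');
  rwhisk : forall x y z (g g' : bhom y z) (b : Hom g g') (f : bhom x y),
    Hom (bcmp g f) (bcmp g' f);
  assoc : forall x y z w (h : bhom z w) (g : bhom y z) (f : bhom x y),
    Hom (bcmp (bcmp h g) f) (bcmp h (bcmp g f));
  assoc_inv : forall x y z w (h : bhom z w) (g : bhom y z) (f : bhom x y),
    Hom (bcmp h (bcmp g f)) (bcmp (bcmp h g) f);
  lunit : forall x y (f : bhom x y), Hom (bcmp (bid y) f) f;
  lunit_inv : forall x y (f : bhom x y), Hom f (bcmp (bid y) f);
  runit : forall x y (f : bhom x y), Hom (bcmp f (bid x)) f;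
  runit_inv : forall x y (f : bhom x y), Hom f (bcmp f (bid x));
  lwhisk_id : forall x y z (g : bhom y z) (f : bhom x y),
    lwhisk g (idm f) = idm (bcmp g f);
  lwhisk_cmp : forall x y z (g : bhom y z) (f f' f'' : bhom x y)
    (a' : Hom f' f'') (a : Hom f f'),
    lwhisk g (a' ∘ a) = lwhisk g a' ∘ lwhisk g a;
  rwhisk_id : forall x y z (g : bhom y z) (f : bhom x y),
    rwhisk (idm g) f = idm (bcmp g f);
  rwhisk_cmp : forall x y z (g g' g'' : bhom y z)
    (b' : Hom g' g'') (b : Hom g g') (f : bhom x y),
    rwhisk (b' ∘ b) f = rwhisk b' f ∘ rwhisk b f;
  interchange : forall x y z (g g' : bhom y z) (f f' : bhom x y)
    (b : Hom g g') (a : Hom f f'),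
    rwhisk b f' ∘ lwhisk g a = lwhisk g' a ∘ rwhisk b f;
  assoc_lwhisk_lwhisk : forall x y z w (h : bhom z w) (g : bhom y z)
    (f f' : bhom x y) (a : Hom f f'),
    assoc h g f' ∘ lwhisk (bcmp h g) a = lwhisk h (lwhisk g a) ∘ assoc h g f;
  assoc_rwhisk_lwhisk : forall x y z w (h : bhom z w) (g g' : bhom y z)
    (b : Hom g g') (f : bhom x y),
    assoc h g' f ∘ rwhisk (lwhisk h b) f = lwhisk h (rwhisk b f) ∘ assoc h g f;
  assoc_rwhisk_rwhisk : forall x y z w (h h' : bhom z w) (c : Hom h h')
    (g : bhom y z) (f : bhom x y),
    assoc h' g f ∘ rwhisk (rwhisk c g) f = rwhisk c (bcmp g f) ∘ assoc h g f;
  lunit_nat : forall x y (f f' : bhom x y) (a : Hom f f'),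
    lunit f' ∘ lwhisk (bid y) a = a ∘ lunit f;
  runit_nat : forall x y (f f' : bhom x y) (a : Hom f f'),
    runit f' ∘ rwhisk a (bid x) = a ∘ runit f;
  assocK : forall x y z w (h : bhom z w) (g : bhom y z) (f : bhom x y),
    assoc_inv h g f ∘ assoc h g f = idm _;
  assoc_invK : forall x y z w (h : bhom z w) (g : bhom y z) (f : bhom x y),
    assoc h g f ∘ assoc_inv h g f = idm _;
  lunitK : forall x y (f : bhom x y), lunit_inv f ∘ lunit f = idm _;
  lunit_invK : forall x y (f : bhom x y), lunit f ∘ lunit_inv f = idm _;
  runitK : forall x y (f : bhom x y), runit_inv f ∘ runit f = idm _;
  runit_invK : forall x y (f : bhom x y), runit f ∘ runit_inv f = idm _;
  triangle : forall x y z (g : bhom y z) (f : bhom x y),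
    lwhisk g (lunit f) ∘ assoc g (bid y) f = rwhisk (runit g) f;
  pentagon : forall x y z w v (k : bhom w v) (h : bhom z w) (g : bhom y z)
    (f : bhom x y),
    assoc k h (bcmp g f) ∘ assoc (bcmp k h) g f =
    lwhisk k (assoc h g f) ∘ assoc k (bcmp h g) f ∘ rwhisk (assoc k h g) f }.

Arguments bhom {_} _ _.
Arguments bid {_} _.
Arguments bcmp {_ _ _ _} _ _.
Arguments lwhisk {_ _ _ _} _ {_ _} _.
Arguments rwhisk {_ _ _ _ _ _} _ _.
Arguments assoc {_ _ _ _ _} _ _ _.
Arguments assoc_inv {_ _ _ _ _} _ _ _.
Arguments lunit {_ _ _} _.
Arguments lunit_inv {_ _ _} _.
Arguments runit {_ _ _} _.
Arguments runit_inv {_ _ _} _.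

Notation "g · f" := (bcmp g f) (at level 39, right associativity) : cat_scope.
Notation "g ◁ a" := (lwhisk g a) (at level 38, right associativity) : cat_scope.
Notation "b ▷ f" := (rwhisk b f) (at level 37, left associativity) : cat_scope.

Program Definition nlwhisk (D E K : Category) (G : Functor E K)
  (F F' : Functor D E) (a : NatTrans F F') : NatTrans (fcmp G F) (fcmp G F') :=
  {| ncomp := fun x => fmap G (a x) |}.
Next Obligation. by move=> * /=; rewrite -!fmap_cmp ncomp_nat. Qed.

Program Definition nrwhisk (D E K : Category) (G G' : Functor E K)
  (b : NatTrans G G') (F : Functor D E) : NatTrans (fcmp G F) (fcmp G' F) :=
  {| ncomp := fun x => b (F x) |}.
Next Obligation. by move=> * /=; rewrite ncomp_nat. Qed.

Program Definition nassoc (D E K L : Category) (H : Functor K L)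
  (G : Functor E K) (F : Functor D E) :
  NatTrans (fcmp (fcmp H G) F) (fcmp H (fcmp G F)) :=
  {| ncomp := fun x => idm (H (G (F x))) |}.
Next Obligation. by move=> * /=; rewrite cmp_idl cmp_idr. Qed.

Program Definition nassoc_inv (D E K L : Category) (H : Functor K L)
  (G : Functor E K) (F : Functor D E) :
  NatTrans (fcmp H (fcmp G F)) (fcmp (fcmp H G) F) :=
  {| ncomp := fun x => idm (H (G (F x))) |}.
Next Obligation. by move=> * /=; rewrite cmp_idl cmp_idr. Qed.

Program Definition nlunit (D E : Category) (F : Functor D E) :
  NatTrans (fcmp (fid E) F) F := {| ncomp := fun x => idm (F x) |}.
Next Obligation. by move=> * /=; rewrite cmp_idl cmp_idr. Qed.

Program Definition nlunit_inv (D E : Category) (F : Functor D E) :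
  NatTrans F (fcmp (fid E) F) := {| ncomp := fun x => idm (F x) |}.
Next Obligation. by move=> * /=; rewrite cmp_idl cmp_idr. Qed.

Program Definition nrunit (D E : Category) (F : Functor D E) :
  NatTrans (fcmp F (fid D)) F := {| ncomp := fun x => idm (F x) |}.
Next Obligation. by move=> * /=; rewrite cmp_idl cmp_idr. Qed.

Program Definition nrunit_inv (D E : Category) (F : Functor D E) :
  NatTrans F (fcmp F (fid D)) := {| ncomp := fun x => idm (F x) |}.
Next Obligation. by move=> * /=; rewrite cmp_idl cmp_idr. Qed.

Local Ltac cat_solve :=
  intros; apply: nat_ext => ? /=;
  rewrite ?fmap_id ?fmap_cmp ?cmp_idl ?cmp_idr ?ncomp_nat //.

Definition CAT : Bicategory.
Proof.
refine {|
  bob := Category;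
  bhom := FunCat;
  bid := fid;
  bcmp := fcmp;
  lwhisk := nlwhisk;
  rwhisk := nrwhisk;
  assoc := nassoc;
  assoc_inv := nassoc_inv;
  lunit := nlunit;
  lunit_inv := nlunit_inv;
  runit := nrunit;
  runit_inv := nrunit_inv |}; abstract cat_solve.
Defined.

Definition Disc (A : Type) : Category := {|
  Ob := A;
  Hom := fun x y => x = y;
  idm := fun x => erefl x;
  cmp := fun x y z (e : y = z) (e' : x = y) => etrans e' e;
  cmp_idl := fun x y f => Prop_irrelevance _ _;
  cmp_idr := fun x y f => Prop_irrelevance _ _;
  cmp_assoc := fun x y z w h g f => Prop_irrelevance _ _ |}.

(* The locally discrete 2-category on a 1-category. *)
Definition LD (C : Category) : Bicategory.
Proof.
refine {|
  bob := C;
  bhom := fun x y => Disc (@Hom C x y);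
  bid := fun x => idm x;
  bcmp := fun x y z g f => @cmp C x y z g f;
  lwhisk := fun x y z g f f' e => congr1 (@cmp C x y z g) e;
  rwhisk := fun x y z g g' e f => congr1 (fun k => @cmp C x y z k f) e;
  assoc := fun x y z w h g f => cmp_assoc h g f;
  assoc_inv := fun x y z w h g f => esym (cmp_assoc h g f);
  lunit := fun x y f => cmp_idl f;
  lunit_inv := fun x y f => esym (cmp_idl f);
  runit := fun x y f => cmp_idr f;
  runit_inv := fun x y f => esym (cmp_idr f) |};
abstract (move=> * /=; exact: Prop_irrelevance).
Defined.

(* Normalized pseudofunctors: by [pnormal], identities are preserved strictly. *)
Record Pseudofunctor (B K : Bicategory) := {
  pob :> B -> K;
  pmap : forall x y : B, bhom x y -> bhom (pob x) (pob y);
  pmap2 : forall (x y : B) (f g : bhom x y), Hom f g -> Hom (pmap f) (pmap g);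
  pcmp : forall (x y z : B) (g : bhom y z) (f : bhom x y),
    Hom (pmap g · pmap f) (pmap (g · f));
  punit : forall x : B, Hom (bid (pob x)) (pmap (bid x));
  pmap2_id : forall (x y : B) (f : bhom x y), pmap2 (idm f) = idm (pmap f);
  pmap2_cmp : forall (x y : B) (f g h : bhom x y) (b : Hom g h) (a : Hom f g),
    pmap2 (b ∘ a) = pmap2 b ∘ pmap2 a;
  pcmp_iso : forall (x y z : B) (g : bhom y z) (f : bhom x y),
    is_iso (pcmp g f);
  pcmp_lwhisk : forall (x y z : B) (g : bhom y z) (f f' : bhom x y)
    (a : Hom f f'), pcmp g f' ∘ (pmap g ◁ pmap2 a) = pmap2 (g ◁ a) ∘ pcmp g f;
  pcmp_rwhisk : forall (x y z : B) (g g' : bhom y z) (b : Hom g g')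
    (f : bhom x y), pcmp g' f ∘ (pmap2 b ▷ pmap f) = pmap2 (b ▷ f) ∘ pcmp g f;
  pcmp_assoc : forall (x y z w : B) (h : bhom z w) (g : bhom y z)
    (f : bhom x y),
    pmap2 (assoc h g f) ∘ pcmp (h · g) f ∘ (pcmp h g ▷ pmap f) =
    pcmp h (g · f) ∘ (pmap h ◁ pcmp g f) ∘ assoc (pmap h) (pmap g) (pmap f);
  pcmp_lunit : forall (x y : B) (f : bhom x y),
    pmap2 (lunit f) ∘ pcmp (bid y) f ∘ (punit y ▷ pmap f) = lunit (pmap f);
  pcmp_runit : forall (x y : B) (f : bhom x y),
    pmap2 (runit f) ∘ pcmp f (bid x) ∘ (pmap f ◁ punit x) = runit (pmap f);
  pnormal : forall x : B,
    exists e : bid (pob x) = pmap (bid x), punit x = cell_of_eq e }.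

Arguments pmap {_ _} _ {_ _} _.
Arguments pmap2 {_ _} _ {_ _ _ _} _.
Arguments pcmp {_ _} _ {_ _ _} _ _.
Arguments punit {_ _} _ _.

Lemma is_iso_cmp (D : Category) (x y z : D) (g : Hom y z) (f : Hom x y) :
  is_iso g -> is_iso f -> is_iso (g ∘ f).
Proof.
move=> [g' [gK gK']] [f' [fK fK']]; exists (f' ∘ g'); split.
  by rewrite cmp_assoc -(cmp_assoc g') gK cmp_idl.
by rewrite cmp_assoc -(cmp_assoc f) fK' cmp_idl.
Qed.

Lemma pmap2_iso (B K : Bicategory) (F : Pseudofunctor B K) (x y : B)
  (f g : bhom x y) (a : Hom f g) : is_iso a -> is_iso (pmap2 F a).
Proof.
move=> [b [h1 h2]]; exists (pmap2 F b).
by rewrite -!pmap2_cmp h1 h2 !pmap2_id.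
Qed.

Definition pscmp (B K L : Bicategory) (G : Pseudofunctor K L)
  (F : Pseudofunctor B K) : Pseudofunctor B L.
Proof.
refine {|
  pob := fun x => G (F x);
  pmap := fun x y f => pmap G (pmap F f);
  pmap2 := fun x y f g a => pmap2 G (pmap2 F a);
  pcmp := fun x y z g f => pmap2 G (pcmp F g f) ∘ pcmp G (pmap F g) (pmap F f);
  punit := fun x => pmap2 G (punit F x) ∘ punit G (F x) |}.
- abstract by intros; rewrite !pmap2_id.
- abstract by intros; rewrite !pmap2_cmp.
- abstract by intros; apply: is_iso_cmp;
    [apply: pmap2_iso; apply: pcmp_iso | apply: pcmp_iso].
- abstract by intros; rewrite cmp_assoc pcmp_lwhisk -!cmp_assoc -!pmap2_cmp
    pcmp_lwhisk.
- abstract by intros; rewrite cmp_assoc pcmp_rwhisk -!cmp_assoc -!pmap2_cmp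
    pcmp_rwhisk.
- abstract by intros; rewrite rwhisk_cmp lwhisk_cmp !cmp_assoc;
    rewrite -(cmp_assoc (pcmp G _ _) (pmap2 G _ ▷ _)) pcmp_rwhisk;
    rewrite -(cmp_assoc (pcmp G _ _) (_ ◁ pmap2 G _)) pcmp_lwhisk;
    rewrite !cmp_assoc -pcmp_assoc -!cmp_assoc -!pmap2_cmp !cmp_assoc
      -pcmp_assoc.
- abstract by intros; rewrite rwhisk_cmp !cmp_assoc;
    rewrite -(cmp_assoc (pcmp G _ _) (pmap2 G _ ▷ _)) pcmp_rwhisk;
    rewrite -!cmp_assoc -!pmap2_cmp !cmp_assoc !pcmp_lunit.
- abstract by intros; rewrite lwhisk_cmp !cmp_assoc;
    rewrite -(cmp_assoc (pcmp G _ _) (_ ◁ pmap2 G _)) pcmp_lwhisk;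
    rewrite -!cmp_assoc -!pmap2_cmp !cmp_assoc !pcmp_runit.
- abstract by move=> x; have [e ->] := pnormal F x;
    have [e' ->] := pnormal G (F x);
    exists (etrans e' (congr1 (fun k => pmap G k) e)); case: _ / e => /=;
    rewrite pmap2_id cmp_idl.
Defined.

Section CatValued.
Variables (C : Category) (F : Pseudofunctor (LD C) CAT).

Definition pcat (x : C) : Category := pob F x.
Definition pfun (x y : C) (f : Hom x y) : Functor (pcat x) (pcat y) :=
  @pmap _ _ F x y f.
Definition pfun_cmp (x y z : C) (g : Hom y z) (f : Hom x y) :
  NatTrans (fcmp (pfun g) (pfun f)) (pfun (g ∘ f)) := @pcmp _ _ F x y z g f.
Definition pfun_unit (x : C) : NatTrans (fid (pcat x)) (pfun (idm x)) :=
  punit F x.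

End CatValued.

(* Naturality in 2-cells is void, [LD C] being locally discrete. *)
Record PseudoNat (C : Category) (F G : Pseudofunctor (LD C) CAT) := {
  pn :> forall x : C, Functor (pcat F x) (pcat G x);
  pn_cell : forall (x y : C) (f : Hom x y),
    NatTrans (fcmp (pfun G f) (pn x)) (fcmp (pn y) (pfun F f));
  pn_iso : forall (x y : C) (f : Hom x y) (a : pcat F x), is_iso (pn_cell f a);
  pn_cmp : forall (x y z : C) (g : Hom y z) (f : Hom x y) (a : pcat F x),
    pn_cell (g ∘ f) a ∘ pfun_cmp G g f (pn x a) =
    fmap (pn z) (pfun_cmp F g f a) ∘ pn_cell g (pfun F f a) ∘
      fmap (pfun G g) (pn_cell f a);
  pn_unit : forall (x : C) (a : pcat F x),
    pn_cell (idm x) a ∘ pfun_unit G x (pn x a) =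
    fmap (pn x) (pfun_unit F x a) }.

Arguments pn_cell {_ _ _} _ {_ _} _.

Record Modification (C : Category) (F G : Pseudofunctor (LD C) CAT)
    (s t : PseudoNat F G) := {
  md :> forall x : C, NatTrans (s x) (t x);
  md_ax : forall (x y : C) (f : Hom x y) (a : pcat F x),
    pn_cell t f a ∘ fmap (pfun G f) (md x a) = md y (pfun F f a) ∘ pn_cell s f a }.

Lemma md_ext (C : Category) (F G : Pseudofunctor (LD C) CAT)
  (s t : PseudoNat F G) (m n : Modification s t) :
  (forall x a, m x a = n x a) -> m = n.
Proof.
case: m n => [m hm] [n hn] /= mn.
have emn : m = n.
  by apply: functional_extensionality_dep => x; apply: nat_ext => a; apply: mn.
by subst m; congr Build_Modification; apply: Prop_irrelevance.
Qed.

Section Bicat.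
Variable C : Category.
Notation PsF := (Pseudofunctor (LD C) CAT).

Program Definition md_id (F G : PsF) (s : PseudoNat F G) : Modification s s :=
  {| md := fun x => nid (s x) |}.
Next Obligation. by move=> * /=; rewrite fmap_id cmp_idl cmp_idr. Qed.

Program Definition md_cmp (F G : PsF) (s t u : PseudoNat F G)
  (n : Modification t u) (m : Modification s t) : Modification s u :=
  {| md := fun x => ncmp (n x) (m x) |}.
Next Obligation.
move=> F G s t u n m x y f a /=.
by rewrite fmap_cmp -cmp_assoc md_ax !cmp_assoc md_ax.
Qed.

Program Definition PsNatCat (F G : PsF) : Category := {|
  Ob := PseudoNat F G;
  Hom := @Modification C F G;
  idm := @md_id F G;
  cmp := @md_cmp F G |}.
Next Obligation. by move=> * /=; apply: md_ext => x a /=; rewrite cmp_idl. Qed.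
Next Obligation. by move=> * /=; apply: md_ext => x a /=; rewrite cmp_idr. Qed.
Next Obligation. by move=> * /=; apply: md_ext => x a /=; rewrite cmp_assoc. Qed.

Program Definition pn_id (F : PsF) : PseudoNat F F := {|
  pn := fun x => fid (pcat F x);
  pn_cell := fun x y f => ncmp (nlunit_inv (pfun F f)) (nrunit (pfun F f)) |}.
Next Obligation.
by move=> * /=; exists (idm _); rewrite !cmp_idl.
Qed.
Next Obligation. by move=> * /=; rewrite fmap_cmp !fmap_id !cmp_idl !cmp_idr. Qed.
Next Obligation. by move=> * /=; rewrite !cmp_idl. Qed.

Lemma is_iso_fmap (D E : Category) (F : Functor D E) (x y : D) (f : Hom x y) :
  is_iso f -> is_iso (fmap F f).
Proof.
move=> [g [h1 h2]]; exists (fmap F g).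
by rewrite -!fmap_cmp h1 h2 !fmap_id.
Qed.

(* The cell of the composite at [a] is
   [H f (t (s a)) -> t (G f (s a)) -> t (s (F f a))]. *)
Program Definition pn_comp (F G H : PsF) (t : PseudoNat G H)
  (s : PseudoNat F G) : PseudoNat F H := {|
  pn := fun x => fcmp (t x) (s x);
  pn_cell := fun x y f => {|
    ncomp := fun a => fmap (t y) (pn_cell s f a) ∘ pn_cell t f (s x a) |} |}.
Next Obligation.
move=> F G H t s x y f a b k /=.
have e1 := ncomp_nat (pn_cell t f) (fmap (s x) k).
have e2 := ncomp_nat (pn_cell s f) k; rewrite /= in e1 e2.
by rewrite cmp_assoc e1 -!cmp_assoc -!fmap_cmp e2.
Qed.
Next Obligation.
by move=> * /=; apply: is_iso_cmp; [apply: is_iso_fmap|]; apply: pn_iso.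
Qed.
Next Obligation.
move=> F G H t s x y z g f a /=.
have e := ncomp_nat (pn_cell t g) (pn_cell s f a); rewrite /= in e.
rewrite cmp_assoc pn_cmp -(cmp_assoc (fmap (t z) (pn_cell s (g ∘ f) a))).
rewrite -fmap_cmp pn_cmp !fmap_cmp.
by rewrite !cmp_assoc -(cmp_assoc (pn_cell t g _)) e !cmp_assoc.
Qed.
Next Obligation.
by move=> F G H t s x a /=; rewrite cmp_assoc pn_unit -fmap_cmp pn_unit.
Qed.

Program Definition md_lwhisk (F G H : PsF) (t : PseudoNat G H)
  (s s' : PseudoNat F G) (m : Modification s s') :
  Modification (pn_comp t s) (pn_comp t s') :=
  {| md := fun x => nlwhisk (t x) (m x) |}.
Next Obligation.
move=> F G H t s s' m x y f a /=.
have e := ncomp_nat (pn_cell t f) (m x a); rewrite /= in e.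
by rewrite cmp_assoc e -!cmp_assoc -!fmap_cmp md_ax.
Qed.

Program Definition md_rwhisk (F G H : PsF) (t t' : PseudoNat G H)
  (n : Modification t t') (s : PseudoNat F G) :
  Modification (pn_comp t s) (pn_comp t' s) :=
  {| md := fun x => nrwhisk (n x) (s x) |}.
Next Obligation.
move=> F G H t t' n s x y f a /=.
by rewrite cmp_assoc md_ax -!cmp_assoc ncomp_nat.
Qed.

Program Definition md_assoc (F G H K : PsF) (u : PseudoNat H K)
  (t : PseudoNat G H) (s : PseudoNat F G) :
  Modification (pn_comp (pn_comp u t) s) (pn_comp u (pn_comp t s)) :=
  {| md := fun x => nassoc (u x) (t x) (s x) |}.
Next Obligation.
by move=> * /=; rewrite fmap_id cmp_idl cmp_idr fmap_cmp cmp_assoc.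
Qed.

Program Definition md_assoc_inv (F G H K : PsF) (u : PseudoNat H K)
  (t : PseudoNat G H) (s : PseudoNat F G) :
  Modification (pn_comp u (pn_comp t s)) (pn_comp (pn_comp u t) s) :=
  {| md := fun x => nassoc_inv (u x) (t x) (s x) |}.
Next Obligation.
by move=> * /=; rewrite fmap_id cmp_idl cmp_idr fmap_cmp cmp_assoc.
Qed.

Program Definition md_lunit (F G : PsF) (s : PseudoNat F G) :
  Modification (pn_comp (pn_id G) s) s := {| md := fun x => nlunit (s x) |}.
Next Obligation. by move=> * /=; rewrite fmap_id !cmp_idl !cmp_idr. Qed.

Program Definition md_lunit_inv (F G : PsF) (s : PseudoNat F G) :
  Modification s (pn_comp (pn_id G) s) := {| md := fun x => nlunit_inv (s x) |}.
Next Obligation. by move=> * /=; rewrite fmap_id !cmp_idl !cmp_idr. Qed.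

Program Definition md_runit (F G : PsF) (s : PseudoNat F G) :
  Modification (pn_comp s (pn_id F)) s := {| md := fun x => nrunit (s x) |}.
Next Obligation. by move=> * /=; rewrite fmap_id !cmp_idl fmap_id !cmp_idl !cmp_idr. Qed.

Program Definition md_runit_inv (F G : PsF) (s : PseudoNat F G) :
  Modification s (pn_comp s (pn_id F)) := {| md := fun x => nrunit_inv (s x) |}.
Next Obligation. by move=> * /=; rewrite fmap_id !cmp_idl fmap_id !cmp_idl !cmp_idr. Qed.

Local Ltac md_solve :=
  intros; apply: md_ext => ? ? /=;
  rewrite ?fmap_id ?fmap_cmp ?cmp_idl ?cmp_idr ?ncomp_nat //.

Definition BICAT : Bicategory.
Proof.
refine {|
  bob := PsF;
  bhom := PsNatCat;
  bid := pn_id;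
  bcmp := pn_comp;
  lwhisk := md_lwhisk;
  rwhisk := md_rwhisk;
  assoc := md_assoc;
  assoc_inv := md_assoc_inv;
  lunit := md_lunit;
  lunit_inv := md_lunit_inv;
  runit := md_runit;
  runit_inv := md_runit_inv |}; abstract md_solve.
Defined.

End Bicat.

Section Limits.
Variable D : Category.

Definition pairs (P B1 B2 Q : D) (q1 : Hom P B1) (q2 : Hom P B2)
  (a : Hom Q B1) (b : Hom Q B2) (u : Hom Q P) : Prop :=
  q1 ∘ u = a /\ q2 ∘ u = b.

Definition is_pullback (A B1 B2 P : D) (f : Hom B1 A) (g : Hom B2 A)
  (q1 : Hom P B1) (q2 : Hom P B2) : Prop :=
  f ∘ q1 = g ∘ q2 /\
  forall (Q : D) (a : Hom Q B1) (b : Hom Q B2), f ∘ a = g ∘ b ->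
    exists! u : Hom Q P, pairs q1 q2 a b u.

Definition is_equalizer (E A B : D) (f g : Hom A B) (e : Hom E A) : Prop :=
  f ∘ e = g ∘ e /\
  forall (Q : D) (a : Hom Q A), f ∘ a = g ∘ a -> exists! u : Hom Q E, e ∘ u = a.

(* [P], with projections [q] and structure map [b], is the [n]-fold fibre power
   of [p] over [A]; for [n = 0] this says that [b] is invertible. *)
Definition is_fpower (A B : D) (p : Hom B A) (n : nat) (P : D) (b : Hom P A)
  (q : 'I_n -> Hom P B) : Prop :=
  (forall i, p ∘ q i = b) /\
  forall (Q : D) (v : Hom Q A) (k : 'I_n -> Hom Q B), (forall i, p ∘ k i = v) ->
    exists! u : Hom Q P, b ∘ u = v /\ forall i, q i ∘ u = k i.

(* [B] over [A] with addition [add : B2 -> B], [B2] being the product of [B]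
   with itself in the slice over [A], and zero [z].  In the associativity law,
   [s = (x,y)], [s' = (x+y,z)], [t = (y,z)], [t' = (x,y+z)]. *)
Record is_cmonoid_over (A B B2 : D) (p : Hom B A) (q1 q2 : Hom B2 B)
    (add : Hom B2 B) (z : Hom A B) : Prop := {
  cmon_add_over : p ∘ add = p ∘ q1;
  cmon_zero_over : p ∘ z = idm A;
  cmon_unit : exists u : Hom B B2,
    pairs q1 q2 (z ∘ p) (idm B) u /\ add ∘ u = idm B;
  cmon_comm : exists u : Hom B2 B2, pairs q1 q2 q2 q1 u /\ add ∘ u = add;
  cmon_assoc : forall (P : D) (b : Hom P A) (q : 'I_3 -> Hom P B),
    is_fpower p b q ->
    let x := q (@Ordinal 3 0 isT) in
    let y := q (@Ordinal 3 1 isT) in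
    let z := q (@Ordinal 3 2 isT) in
    exists s s' t t' : Hom P B2,
      pairs q1 q2 x y s /\ pairs q1 q2 (add ∘ s) z s' /\
      pairs q1 q2 y z t /\ pairs q1 q2 x (add ∘ t) t' /\
      add ∘ s' = add ∘ t' }.

End Limits.

Fixpoint fpow (D : Category) (T : Functor D D) (m : nat) : Functor D D :=
  if m is m'.+1 then fcmp T (fpow T m') else fid D.

(* [tT2] is the chosen double fibre power, i.e. the domain of the addition. *)
Record TangentData (D : Category) := {
  tT : Functor D D;
  tp : NatTrans tT (fid D);
  tz : NatTrans (fid D) tT;
  tT2 : Functor D D;
  tpi1 : NatTrans tT2 tT;
  tpi2 : NatTrans tT2 tT;
  tadd : NatTrans tT2 tT;
  tl : NatTrans tT (fcmp tT tT);
  tc : NatTrans (fcmp tT tT) (fcmp tT tT) }.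

Section TangentAxioms.
Variables (D : Category) (d : TangentData D).
Local Notation T := (tT d).
Local Notation T2 := (tT2 d).
Local Notation p := (tp d).
Local Notation zr := (tz d).
Local Notation pi1 := (tpi1 d).
Local Notation pi2 := (tpi2 d).
Local Notation add := (tadd d).
Local Notation l := (tl d).
Local Notation c := (tc d).

(* [v] is T(+) ∘ ⟨l π1, 0_T π2⟩. *)
Definition is_vlift (A : D) (v : Hom (T2 A) (T (T A))) : Prop :=
  exists u : Hom (T2 A) (T (T2 A)),
    pairs (fmap T (pi1 A)) (fmap T (pi2 A)) (l A ∘ pi1 A) (zr (T A) ∘ pi2 A) u /\
    v = fmap T (add A) ∘ u.

Record is_tangent : Prop := {
  tan_T2 : forall (A : D) (m : nat),
    is_pullback (fmap (fpow T m) (p A)) (fmap (fpow T m) (p A))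
                (fmap (fpow T m) (pi1 A)) (fmap (fpow T m) (pi2 A));
  tan_powers : forall (A : D) (n : nat),
    exists (P : D) (b : Hom P A) (q : 'I_n -> Hom P (T A)),
      is_fpower (p A) b q /\
      forall m, is_fpower (fmap (fpow T m) (p A)) (fmap (fpow T m) b)
                          (fun i => fmap (fpow T m) (q i));
  tan_cmonoid : forall A : D,
    is_cmonoid_over (p A) (pi1 A) (pi2 A) (add A) (zr A);
  tan_l_p : forall A : D, fmap T (p A) ∘ l A = zr A ∘ p A;
  tan_l_add : forall A : D, exists u : Hom (T2 A) (T (T2 A)),
    pairs (fmap T (pi1 A)) (fmap T (pi2 A)) (l A ∘ pi1 A) (l A ∘ pi2 A) u /\
    l A ∘ add A = fmap T (add A) ∘ u;
  tan_l_zero : forall A : D, l A ∘ zr A = fmap T (zr A) ∘ zr A;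
  tan_c_p : forall A : D, p (T A) ∘ c A = fmap T (p A);
  tan_c_add : forall A : D, exists u : Hom (T (T2 A)) (T2 (T A)),
    pairs (pi1 (T A)) (pi2 (T A))
          (c A ∘ fmap T (pi1 A)) (c A ∘ fmap T (pi2 A)) u /\
    c A ∘ fmap T (add A) = add (T A) ∘ u;
  tan_c_zero : forall A : D, c A ∘ fmap T (zr A) = zr (T A);
  tan_c_c : forall A : D, c A ∘ c A = idm (T (T A));
  tan_c_l : forall A : D, c A ∘ l A = l A;
  tan_l_l : forall A : D, fmap T (l A) ∘ l A = l (T A) ∘ l A;
  tan_yang_baxter : forall A : D,
    c (T A) ∘ fmap T (c A) ∘ c (T A) = fmap T (c A) ∘ c (T A) ∘ fmap T (c A);
  tan_c_c_l : forall A : D,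
    c (T A) ∘ fmap T (c A) ∘ l (T A) = fmap T (l A) ∘ c A;
  tan_vlift : forall A : D, exists v : Hom (T2 A) (T (T A)),
    is_vlift v /\
    is_equalizer (fmap T (p A)) (zr A ∘ p A ∘ p (T A)) v }.

End TangentAxioms.

Record TangentCat := {
  tcat :> Category;
  tdata : TangentData tcat;
  tangent_ax : is_tangent tdata }.

Section StrongMorphism.
Variables (D E : Category) (dD : TangentData D) (dE : TangentData E).
Variables (H : Functor D E).
Variable alpha : NatTrans (fcmp H (tT dD)) (fcmp (tT dE) H).
Local Notation T := (tT dD).
Local Notation S := (tT dE).

Record is_strong : Prop := {
  strong_powers : forall (A : D) (n : nat) (P : D) (b : Hom P A)
    (q : 'I_n -> Hom P (T A)), is_fpower (tp dD A) b q ->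
    is_fpower (fmap H (tp dD A)) (fmap H b) (fun i => fmap H (q i));
  strong_equalizers : forall (A : D) (v : Hom (tT2 dD A) (T (T A))),
    is_vlift v ->
    is_equalizer (fmap H (fmap T (tp dD A)))
      (fmap H (tz dD A ∘ tp dD A ∘ tp dD (T A))) (fmap H v);
  strong_iso : forall A : D, is_iso (alpha A);
  strong_p : forall A : D, tp dE (H A) ∘ alpha A = fmap H (tp dD A);
  strong_zero : forall A : D, alpha A ∘ fmap H (tz dD A) = tz dE (H A);
  strong_add : forall A : D,
    exists alpha2 : Hom (H (tT2 dD A)) (tT2 dE (H A)),
      pairs (tpi1 dE (H A)) (tpi2 dE (H A))
        (alpha A ∘ fmap H (tpi1 dD A)) (alpha A ∘ fmap H (tpi2 dD A)) alpha2 /\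
      alpha A ∘ fmap H (tadd dD A) = tadd dE (H A) ∘ alpha2;
  strong_l : forall A : D,
    tl dE (H A) ∘ alpha A = fmap S (alpha A) ∘ alpha (T A) ∘ fmap H (tl dD A);
  strong_c : forall A : D,
    tc dE (H A) ∘ fmap S (alpha A) ∘ alpha (T A) =
    fmap S (alpha A) ∘ alpha (T A) ∘ fmap H (tc dD A) }.

End StrongMorphism.

Record StrongMor (D E : TangentCat) := {
  sfun :> Functor D E;
  scell : NatTrans (fcmp sfun (tT (tdata D))) (fcmp (tT (tdata E)) sfun);
  strong_ax : is_strong scell }.

Record TanCell (D E : TangentCat) (H K : StrongMor D E) := {
  tcell :> NatTrans H K;
  tcell_ax : forall A : D,
    fmap (tT (tdata E)) (tcell A) ∘ scell H A =
    scell K A ∘ tcell (tT (tdata D) A) }.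

Lemma tcell_ext (D E : TangentCat) (H K : StrongMor D E) (r s : TanCell H K) :
  (forall A, r A = s A) -> r = s.
Proof.
case: r s => [r hr] [s hs] /= rs.
have e : r = s by apply: nat_ext.
by subst r; congr Build_TanCell; apply: Prop_irrelevance.
Qed.

Lemma is_fpower_iso (D : Category) (A B B' : D) (p : Hom B A) (p' : Hom B' A)
  (a : Hom B B') n (P : D) (b : Hom P A) (q : 'I_n -> Hom P B) :
  is_iso a -> p' ∘ a = p ->
  is_fpower p b q <-> is_fpower p' b (fun i => a ∘ q i).
Proof.
move=> [a' [a'K aK]] pa.
have pa' : p ∘ a' = p' by rewrite -pa cmp_assoc aK cmp_idr.
split=> -[h1 h2]; split.
- by move=> i; rewrite -cmp_assoc pa h1.
- move=> Q v k hk; have [i|u [[u1 u2] uu]] := h2 Q v (fun i => a' ∘ k i).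
    by rewrite -cmp_assoc pa'.
  exists u; split; first split=> // i.
    by rewrite cmp_assoc u2 -cmp_assoc aK cmp_idl.
  move=> w [w1 w2]; apply: uu; split=> // i.
  by rewrite -w2 -!cmp_assoc a'K cmp_idl.
- by move=> i; rewrite -(h1 i) -cmp_assoc pa.
- move=> Q v k hk; have [i|u [[u1 u2] uu]] := h2 Q v (fun i => a ∘ k i).
    by rewrite -cmp_assoc pa.
  exists u; split; first split=> // i.
    have := u2 i; rewrite cmp_assoc => /(congr1 (fun x => a' ∘ x)).
    by rewrite -!cmp_assoc a'K !cmp_idl.
  move=> w [w1 w2]; apply: uu; split=> // i.
  by rewrite -w2 cmp_assoc.
Qed.

Lemma is_equalizer_iso (D : Category) (E A B A' B' : D) (f g : Hom A B)
  (f' g' : Hom A' B') (a : Hom A A') (b : Hom B B') (e : Hom E A) :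
  is_iso a -> is_iso b -> f' ∘ a = b ∘ f -> g' ∘ a = b ∘ g ->
  is_equalizer f g e <-> is_equalizer f' g' (a ∘ e).
Proof.
move=> [a' [a'K aK]] [b' [b'K bK]] hf hg.
have cancel_b : forall X (x y : Hom X B), b ∘ x = b ∘ y -> x = y.
  move=> X x y /(congr1 (fun x => b' ∘ x)).
  by rewrite -!cmp_assoc b'K !cmp_idl.
have cancel_a : forall X (x y : Hom X A), a ∘ x = a ∘ y -> x = y.
  move=> X x y /(congr1 (fun x => a' ∘ x)).
  by rewrite -!cmp_assoc a'K !cmp_idl.
split=> -[h1 h2]; split.
- by rewrite -!cmp_assoc hf hg !cmp_assoc h1.
- move=> Q x hx; have [|u [u1 uu]] := h2 Q (a' ∘ x).
    apply: cancel_b; rewrite -!cmp_assoc -hf -hg !cmp_assoc.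
    by rewrite -!(cmp_assoc a a') aK !cmp_idl.
  exists u; split; first by rewrite cmp_assoc u1 -cmp_assoc aK cmp_idl.
  move=> w hw; apply: uu; apply: cancel_a.
  by rewrite -!cmp_assoc aK cmp_idl.
- by apply: cancel_b; rewrite -!cmp_assoc -hf -hg !cmp_assoc h1.
- move=> Q x hx; have [|u [u1 uu]] := h2 Q (a ∘ x).
    by rewrite -!cmp_assoc hf hg !cmp_assoc hx.
  exists u; split; first by apply: cancel_a; rewrite -cmp_assoc.
  by move=> w hw; apply: uu; rewrite cmp_assoc hw.
Qed.

Lemma is_equalizer_unique (D : Category) (E E' A B : D) (f g : Hom A B)
  (e : Hom E A) (e' : Hom E' A) : is_equalizer f g e -> is_equalizer f g e' ->
  exists t : Hom E E', is_iso t /\ e' ∘ t = e.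
Proof.
move=> [h1 h2] [h1' h2'].
have [t [ht _]] := h2' _ _ h1; have [s [hs _]] := h2 _ _ h1'.
have [r [_ ur]] := h2 _ _ h1; have [r' [_ ur']] := h2' _ _ h1'.
exists t; split=> //; exists s; split.
  by rewrite -(ur (idm _)) ?cmp_idr //; symmetry; apply: ur;
     rewrite -cmp_assoc hs.
by rewrite -(ur' (idm _)) ?cmp_idr //; symmetry; apply: ur';
   rewrite -cmp_assoc ht.
Qed.

Lemma is_equalizer_precomp (D : Category) (E E' A B : D) (f g : Hom A B)
  (e : Hom E' A) (t : Hom E E') :
  is_iso t -> is_equalizer f g e -> is_equalizer f g (e ∘ t).
Proof.
move=> [s [sK tK]] [h1 h2]; split; first by rewrite -!cmp_assoc h1.
move=> Q x /h2[u [hu uu]]; exists (s ∘ u); split.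
  by rewrite cmp_assoc -(cmp_assoc t) tK cmp_idl.
move=> w hw; rewrite (uu (t ∘ w)); first by rewrite -cmp_assoc sK cmp_idl.
by rewrite -cmp_assoc.
Qed.

Program Definition sm_id (D : TangentCat) : StrongMor D D := {|
  sfun := fid D;
  scell := ncmp (nrunit_inv (tT (tdata D))) (nlunit (tT (tdata D))) |}.
Next Obligation.
move=> D; split=> //=; try by move=> *; rewrite !cmp_idl ?fmap_id ?cmp_idl ?cmp_idr.
- move=> A v hv; have [v' [hv' he]] := tan_vlift (tangent_ax D) A.
  suff -> : v = v' by [].
  case: hv => u [[u1 u2] ->]; case: hv' => u' [[u1' u2'] ->].
  have [hc hu] := tan_T2 (tangent_ax D) A 1.
  have [|w [_ uw]] := hu _ (fmap (tT (tdata D)) (tpi1 (tdata D) A) ∘ u)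
                           (fmap (tT (tdata D)) (tpi2 (tdata D) A) ∘ u).
    by have := congr1 (fun x => x ∘ u) hc; rewrite /= !cmp_assoc.
  by rewrite -(uw u) // -(uw u') //; split; rewrite /= ?u1 ?u2.
- by move=> A; exists (idm _); rewrite !cmp_idl.
- move=> A; exists (idm _); split; last by rewrite !cmp_idl cmp_idr.
  by split; rewrite !cmp_idl cmp_idr.
Qed.

Program Definition sm_cmp (D E G : TangentCat) (K : StrongMor E G)
  (H : StrongMor D E) : StrongMor D G := {|
  sfun := fcmp K H;
  scell := {| ncomp := fun A => scell K (H A) ∘ fmap K (scell H A) |} |}.
Next Obligation.
move=> D E G K H A B f /=.
have e1 := ncomp_nat (scell H) f; have e2 := ncomp_nat (scell K) (fmap H f).
rewrite /= in e1 e2.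
by rewrite cmp_assoc -fmap_cmp e1 fmap_cmp -cmp_assoc e2 cmp_assoc.
Qed.
Next Obligation.
move=> D E G K H.
have sH := strong_ax H; have sK := strong_ax K.
have nH A B (f : Hom A B) := ncomp_nat (scell H) f.
have nK A B (f : Hom A B) := ncomp_nat (scell K) f.
rewrite /= in nH nK.
split=> /=.
- move=> A n P b q hq.
  have hp : fmap K (tp (tdata E) (H A)) ∘ fmap K (scell H A) =
            fmap K (fmap H (tp (tdata D) A)).
    by rewrite -fmap_cmp (strong_p sH).
  apply/(is_fpower_iso _ _ (is_iso_fmap K (strong_iso sH A)) hp).
  have := strong_powers sH hq.
  move/(is_fpower_iso _ _ (strong_iso sH A) (strong_p sH A)).
  move/(strong_powers sK).
  by congr is_fpower; apply: functional_extensionality_dep => i; rewrite fmap_cmp.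
- move=> A v hv.
  set S := tT (tdata E); set T := tT (tdata D).
  pose a := fmap S (scell H A) ∘ scell H (T A).
  have ia : is_iso a.
    by apply: is_iso_cmp; [apply: is_iso_fmap|]; apply: strong_iso sH _.
  have ha1 : fmap S (tp (tdata E) (H A)) ∘ a =
             scell H A ∘ fmap H (fmap T (tp (tdata D) A)).
    by rewrite -cmp_assoc -fmap_cmp (strong_p sH) nH.
  have np := ncomp_nat (tp (tdata E)) (scell H A); rewrite /= in np.
  have ha2 : (tz (tdata E) (H A) ∘ tp (tdata E) (H A) ∘
                tp (tdata E) (S (H A))) ∘ a =
             scell H A ∘ fmap H (tz (tdata D) A ∘ tp (tdata D) A ∘
                                   tp (tdata D) (T A)).
    rewrite !cmp_assoc -(cmp_assoc _ _ (scell H (T A))) np.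
    rewrite !cmp_assoc (strong_p sH) -(cmp_assoc _ (scell H A)) (strong_p sH).
    by rewrite !fmap_cmp -cmp_assoc -(strong_zero sH) !cmp_assoc.
  have eqHv := strong_equalizers sH hv.
  have eqaHv := proj1 (is_equalizer_iso _ ia (strong_iso sH A) ha1 ha2) eqHv.
  have [v' [hv' ev']] := tan_vlift (tangent_ax E) (H A).
  have [t [it ht]] := is_equalizer_unique eqaHv ev'.
  have eqKv' := strong_equalizers sK hv'.
  have := is_equalizer_precomp (is_iso_fmap K it) eqKv'.
  rewrite -fmap_cmp ht (fmap_cmp K a) => hh.
  have iff := is_equalizer_iso (fmap K (fmap H v)) (is_iso_fmap K ia)
                (is_iso_fmap K (strong_iso sH A)).
  apply: (proj2 (iff _ _ _ _ _ _) hh).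
  + by rewrite -!fmap_cmp ha1.
  + by rewrite -!fmap_cmp ha2.
- move=> A; apply: is_iso_cmp; first exact: strong_iso sK _.
  by apply: is_iso_fmap; apply: strong_iso sH _.
- by move=> A; rewrite -cmp_assoc (strong_p sK) -fmap_cmp (strong_p sH).
- by move=> A; rewrite cmp_assoc -fmap_cmp (strong_zero sH) (strong_zero sK).
- move=> A; have [a2 [[h1 h2] h3]] := strong_add sH A.
  have [b2 [[k1 k2] k3]] := strong_add sK (H A).
  exists (b2 ∘ fmap K a2); split; [split|].
  + by rewrite -cmp_assoc k1 !cmp_assoc -!fmap_cmp h1.
  + by rewrite -cmp_assoc k2 !cmp_assoc -!fmap_cmp h2.
  + by rewrite -cmp_assoc -k3 !cmp_assoc -!fmap_cmp h3.
- move=> A; rewrite -cmp_assoc (strong_l sK) !cmp_assoc.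
  rewrite -(fmap_cmp K (tl (tdata E) (H A)) (scell H A)) (strong_l sH).
  rewrite !fmap_cmp !cmp_assoc -(cmp_assoc _ _ (fmap K (scell H _) ∘ _)) nK.
  by rewrite !cmp_assoc.
- move=> A.
  have e1 := congr1 (fun x => fmap K x) (strong_c sH A); rewrite /= in e1.
  rewrite !(fmap_cmp K) in e1.
  have e2 := strong_c sK (H A).
  have e3 := nK _ _ (scell H A).
  rewrite fmap_cmp !cmp_assoc.
  rewrite -!(cmp_assoc (fmap (tT (tdata G)) (fmap K (scell H A)))) -e3.
  rewrite !cmp_assoc -e1 -!cmp_assoc; congr (_ ∘ _); congr (_ ∘ _).
  by rewrite !cmp_assoc e2.
Qed.

Program Definition tc_id (D E : TangentCat) (H : StrongMor D E) : TanCell H H :=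
  {| tcell := nid H |}.
Next Obligation. by move=> * /=; rewrite fmap_id cmp_idl cmp_idr. Qed.

Program Definition tc_cmp (D E : TangentCat) (H K L : StrongMor D E)
  (s : TanCell K L) (r : TanCell H K) : TanCell H L := {| tcell := ncmp s r |}.
Next Obligation.
move=> D E H K L s r A /=.
by rewrite fmap_cmp cmp_assoc tcell_ax -!cmp_assoc tcell_ax.
Qed.

Program Definition StrongCat (D E : TangentCat) : Category := {|
  Ob := StrongMor D E;
  Hom := @TanCell D E;
  idm := @tc_id D E;
  cmp := @tc_cmp D E |}.
Next Obligation. by move=> * /=; apply: tcell_ext => A /=; rewrite cmp_idl. Qed.
Next Obligation. by move=> * /=; apply: tcell_ext => A /=; rewrite cmp_idr. Qed.
Next Obligation. by move=> * /=; apply: tcell_ext => A /=; rewrite cmp_assoc. Qed.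

Program Definition tc_lwhisk (D E G : TangentCat) (K : StrongMor E G)
  (H H' : StrongMor D E) (r : TanCell H H') :
  TanCell (sm_cmp K H) (sm_cmp K H') := {| tcell := nlwhisk K r |}.
Next Obligation.
move=> D E G K H H' r A /=; have e := ncomp_nat (scell K) (r A).
rewrite /= in e.
by rewrite -cmp_assoc -e cmp_assoc -fmap_cmp tcell_ax fmap_cmp cmp_assoc.
Qed.

Program Definition tc_rwhisk (D E G : TangentCat) (K K' : StrongMor E G)
  (s : TanCell K K') (H : StrongMor D E) :
  TanCell (sm_cmp K H) (sm_cmp K' H) := {| tcell := nrwhisk s H |}.
Next Obligation.
move=> D E G K K' s H A /=.
by rewrite -cmp_assoc tcell_ax !cmp_assoc ncomp_nat.
Qed.

Program Definition tc_assoc (D E G L : TangentCat) (M : StrongMor G L)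
  (K : StrongMor E G) (H : StrongMor D E) :
  TanCell (sm_cmp (sm_cmp M K) H) (sm_cmp M (sm_cmp K H)) :=
  {| tcell := nassoc M K H |}.
Next Obligation.
by move=> * /=; rewrite fmap_id cmp_idl cmp_idr fmap_cmp cmp_assoc.
Qed.

Program Definition tc_assoc_inv (D E G L : TangentCat) (M : StrongMor G L)
  (K : StrongMor E G) (H : StrongMor D E) :
  TanCell (sm_cmp M (sm_cmp K H)) (sm_cmp (sm_cmp M K) H) :=
  {| tcell := nassoc_inv M K H |}.
Next Obligation.
by move=> * /=; rewrite fmap_id cmp_idl cmp_idr fmap_cmp cmp_assoc.
Qed.

Program Definition tc_lunit (D E : TangentCat) (H : StrongMor D E) :
  TanCell (sm_cmp (sm_id E) H) H := {| tcell := nlunit H |}.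
Next Obligation. by move=> * /=; rewrite fmap_id !cmp_idl cmp_idr. Qed.

Program Definition tc_lunit_inv (D E : TangentCat) (H : StrongMor D E) :
  TanCell H (sm_cmp (sm_id E) H) := {| tcell := nlunit_inv H |}.
Next Obligation. by move=> * /=; rewrite fmap_id !cmp_idl cmp_idr. Qed.

Program Definition tc_runit (D E : TangentCat) (H : StrongMor D E) :
  TanCell (sm_cmp H (sm_id D)) H := {| tcell := nrunit H |}.
Next Obligation.
by move=> * /=; rewrite fmap_id !cmp_idl fmap_id !cmp_idr.
Qed.

Program Definition tc_runit_inv (D E : TangentCat) (H : StrongMor D E) :
  TanCell H (sm_cmp H (sm_id D)) := {| tcell := nrunit_inv H |}.
Next Obligation.
by move=> * /=; rewrite fmap_id !cmp_idl fmap_id !cmp_idr.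
Qed.

Local Ltac tc_solve :=
  intros; apply: tcell_ext => ? /=;
  rewrite ?fmap_id ?fmap_cmp ?cmp_idl ?cmp_idr ?ncomp_nat //.

Definition TAN : Bicategory.
Proof.
refine {|
  bob := TangentCat;
  bhom := StrongCat;
  bid := sm_id;
  bcmp := sm_cmp;
  lwhisk := tc_lwhisk;
  rwhisk := tc_rwhisk;
  assoc := tc_assoc;
  assoc_inv := tc_assoc_inv;
  lunit := tc_lunit;
  lunit_inv := tc_lunit_inv;
  runit := tc_runit;
  runit_inv := tc_runit_inv |}; abstract tc_solve.
Defined.

Lemma is_iso_id (D : Category) (x : D) : is_iso (idm x).
Proof. by exists (idm x); rewrite cmp_idl. Qed.

Definition Forget : Pseudofunctor TAN CAT.
Proof.
refine {|
  pob := (fun D : TAN => tcat D) : TAN -> CAT;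
  pmap := fun D E H => sfun H;
  pmap2 := fun D E H K r => tcell r;
  pcmp := fun D E G K H => idm (fcmp K H : bhom (tcat D : CAT) (tcat G : CAT));
  punit := fun D => idm (fid D : bhom (tcat D : CAT) (tcat D : CAT)) |}.
- abstract by [].
- abstract by [].
- abstract (intros; exact: is_iso_id).
- abstract (intros; apply: nat_ext => ? /=; rewrite !cmp_idl !cmp_idr //).
- abstract (intros; apply: nat_ext => ? /=; rewrite !cmp_idl !cmp_idr //).
- abstract (intros; apply: nat_ext => ? /=; rewrite fmap_id !cmp_idl //).
- abstract (intros; apply: nat_ext => ? /=; rewrite !cmp_idl //).
- abstract (intros; apply: nat_ext => ? /=; rewrite fmap_id !cmp_idl //).
- abstract (by move=> D; exists erefl).
Defined.

Record TObjData (K : Bicategory) (X : K) := {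
  oT : bhom X X;
  opr : Hom oT (bid X);
  oz : Hom (bid X) oT;
  oT2 : bhom X X;
  opi1 : Hom oT2 oT;
  opi2 : Hom oT2 oT;
  oadd : Hom oT2 oT;
  ol : Hom oT (oT · oT);
  oc : Hom (oT · oT) (oT · oT) }.

Fixpoint bpow (K : Bicategory) (X : K) (T : bhom X X) (m : nat) : bhom X X :=
  if m is m'.+1 then T · bpow T m' else bid X.

Section TangentObjectAxioms.
Variables (K : Bicategory) (X : K) (d : TObjData X).
Local Notation T := (oT d).
Local Notation T2 := (oT2 d).
Local Notation p := (opr d).
Local Notation zr := (oz d).
Local Notation pi1 := (opi1 d).
Local Notation pi2 := (opi2 d).
Local Notation add := (oadd d).
Local Notation l := (ol d).
Local Notation c := (oc d).

(* The whiskered cells T(p), p_T, T(0), 0_T, l_T, c_T with the coherence cells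
   that give them their usual (co)domains. *)
Definition Tp : Hom (T · T) T := runit T ∘ (T ◁ p).
Definition pT : Hom (T · T) T := lunit T ∘ (p ▷ T).
Definition Tz : Hom T (T · T) := (T ◁ zr) ∘ runit_inv T.
Definition zT : Hom T (T · T) := (zr ▷ T) ∘ lunit_inv T.
Definition lT : Hom (T · T) (T · (T · T)) := assoc T T T ∘ (l ▷ T).
Definition cT : Hom (T · (T · T)) (T · (T · T)) :=
  assoc T T T ∘ (c ▷ T) ∘ assoc_inv T T T.

(* Fibre powers and their images under post-composition with [T^m] are limits
   in [K(X,X)] and pointwise, i.e. remain limits after precomposition with any
   [f : X' -> X]. *)
Record is_tangent_object : Prop := {
  tob_T2 : is_pullback p p pi1 pi2;
  tob_T2_pointwise : forall (m : nat) (X' : K) (f : bhom X' X),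
    is_pullback ((bpow T m ◁ p) ▷ f) ((bpow T m ◁ p) ▷ f)
                ((bpow T m ◁ pi1) ▷ f) ((bpow T m ◁ pi2) ▷ f);
  tob_powers : forall n : nat,
    exists (P : bhom X X) (b : Hom P (bid X)) (q : 'I_n -> Hom P T),
      is_fpower p b q /\
      forall (m : nat) (X' : K) (f : bhom X' X),
        is_fpower ((bpow T m ◁ p) ▷ f) ((bpow T m ◁ b) ▷ f)
                  (fun i => (bpow T m ◁ q i) ▷ f);
  tob_cmonoid : is_cmonoid_over p pi1 pi2 add zr;
  tob_l_p : Tp ∘ l = zr ∘ p;
  tob_l_add : exists u : Hom T2 (T · T2),
    pairs (T ◁ pi1) (T ◁ pi2) (l ∘ pi1) (l ∘ pi2) u /\
    l ∘ add = (T ◁ add) ∘ u;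
  tob_l_zero : l ∘ zr = Tz ∘ zr;
  tob_c_p : pT ∘ c = Tp;
  tob_c_add : exists u : Hom (T · T2) (T2 · T),
    pairs (pi1 ▷ T) (pi2 ▷ T) (c ∘ (T ◁ pi1)) (c ∘ (T ◁ pi2)) u /\
    c ∘ (T ◁ add) = (add ▷ T) ∘ u;
  tob_c_zero : c ∘ Tz = zT;
  tob_c_c : c ∘ c = idm (T · T);
  tob_c_l : c ∘ l = l;
  tob_l_l : (T ◁ l) ∘ l = lT ∘ l;
  tob_yang_baxter : cT ∘ (T ◁ c) ∘ cT = (T ◁ c) ∘ cT ∘ (T ◁ c);
  tob_c_c_l : cT ∘ (T ◁ c) ∘ lT = (T ◁ l) ∘ c;
  tob_vlift : exists u : Hom T2 (T · T2),
    pairs (T ◁ pi1) (T ◁ pi2) (l ∘ pi1) (zT ∘ pi2) u /\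
    let v := (T ◁ add) ∘ u in
    is_pullback Tp zr v (p ∘ pi1) /\
    forall (X' : K) (f : bhom X' X),
      is_pullback (Tp ▷ f) (zr ▷ f) (v ▷ f) ((p ∘ pi1) ▷ f) }.

End TangentObjectAxioms.

Record TangentObject (K : Bicategory) := {
  tobj : K;
  tobj_data : TObjData tobj;
  tobj_ax : is_tangent_object tobj_data }.

Section Correspondence.
Variables (C : Category) (X : TangentObject (BICAT C)).

Definition tobj_psf : Pseudofunctor (LD C) CAT := tobj X.
Definition tobj_T : PseudoNat tobj_psf tobj_psf := oT (tobj_data X).
Definition tobj_T2 : PseudoNat tobj_psf tobj_psf := oT2 (tobj_data X).

Definition tobj_at (x : C) : TangentData (pcat tobj_psf x) := {|
  tT := tobj_T x;
  tp := (opr (tobj_data X) : Modification tobj_T (pn_id tobj_psf)) x;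
  tz := (oz (tobj_data X) : Modification (pn_id tobj_psf) tobj_T) x;
  tT2 := tobj_T2 x;
  tpi1 := (opi1 (tobj_data X) : Modification tobj_T2 tobj_T) x;
  tpi2 := (opi2 (tobj_data X) : Modification tobj_T2 tobj_T) x;
  tadd := (oadd (tobj_data X) : Modification tobj_T2 tobj_T) x;
  tl := (ol (tobj_data X) :
           Modification tobj_T (pn_comp tobj_T tobj_T)) x;
  tc := (oc (tobj_data X) :
           Modification (pn_comp tobj_T tobj_T) (pn_comp tobj_T tobj_T)) x |}.

End Correspondence.

(* A tangent morphism without its axioms, packed with its source and target:
   the type in which values of a tangent object and of a [TAN]-valued
   pseudofunctor at an arrow can be compared. *)
Record TanMorData := {
  tm_src : Category;
  tm_tgt : Category;
  tm_src_data : TangentData tm_src;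
  tm_tgt_data : TangentData tm_tgt;
  tm_fun : Functor tm_src tm_tgt;
  tm_cell : NatTrans (fcmp tm_fun (tT tm_src_data))
                     (fcmp (tT tm_tgt_data) tm_fun) }.

Definition strong_data (D E : TangentCat) (H : StrongMor D E) : TanMorData :=
  {| tm_src_data := tdata D; tm_tgt_data := tdata E;
     tm_fun := sfun H; tm_cell := scell H |}.

Definition tobj_mor (C : Category) (X : TangentObject (BICAT C)) (x y : C)
  (f : Hom x y) : TanMorData :=
  {| tm_src_data := tobj_at X x; tm_tgt_data := tobj_at X y;
     tm_fun := pfun (tobj_psf X) f; tm_cell := pn_cell (tobj_T X) f |}.

(* The values of [G] are those of [X] at the objects and at the arrows: the
   tangent category [G x] is [F x] with the components at [x] of the cells of
   [X], and the tangent morphism [G f] is [F f] with the cell of [T] at [f]. *)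
Definition same_tangent_data (C : Category) (X : TangentObject (BICAT C))
    (G : Pseudofunctor (LD C) TAN) : Prop :=
  (forall x : C,
     existT TangentData (tcat (pob G x)) (tdata (pob G x)) =
     existT TangentData (pcat (tobj_psf X) x) (tobj_at X x)) /\
  (forall (x y : C) (f : Hom x y),
     strong_data (@pmap _ _ G x y f) = tobj_mor X f).

(* Main.v *)
(* A pseudonatural transformation B(x, -) => F is determined up to isomorphism
   by an object of F x, so precomposition with such transformations turns the
   pointwise limits of a tangent object into limits in each category F x; the
   tangent cells of F then make every F x a tangent category, and pseudonaturality
   of T and of the fibre powers makes every F f a strong tangent morphism.
   Conversely, limits of pseudonatural transformations are computed objectwise,
   and the pseudonaturality cell of a fibre power T_n is the unique map into the
   fibre power induced by the cell of T; it is invertible because strong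
   morphisms preserve fibre powers.  In particular the cell of T_2 carries no
   information, which makes the two constructions mutually inverse. *)
Require Import Defs.
#[warnings="-notation-overridden"]
From mathcomp Require Import ssreflect ssrfun ssrbool eqtype ssrnat fintype.
From mathcomp Require Import boolp.

Set Implicit Arguments.
Unset Strict Implicit.
Unset Printing Implicit Defensive.

Local Open Scope cat_scope.

(** Two mismatches between the definitions shape the argument. The vertical lift is universal as a
    pullback for a tangent object and as an equalizer for a tangent category; since 0 is a section
    of p and p ∘ T(p) = p ∘ p_T, the second leg of a pullback cone is forced, and the two conditions
    agree. Tangent categories provide the powers T_n objectwise only, so T_n as a functor and as a
    pseudonatural transformation comes from choice; this is harmless, because T_2 is the only power
    recorded as data, and its functor is given on both sides. Normalization gives limits at A
    itself: evaluating a Yoneda transformation at the identity yields F(id)(A), which is equal and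
    not merely isomorphic to A. Bijectivity is an equality of dependent records, not an equivalence.
    The coherence cells are therefore taken over unchanged in both directions, so that all data
    except the cell of T_2 agree by computation. *)

Section LimitLemmas.
Variable D : Category.

Lemma cmpA (x y z w : D) (h : Hom z w) (g : Hom y z) (f : Hom x y) :
  h ∘ (g ∘ f) = (h ∘ g) ∘ f.
Proof. by rewrite cmp_assoc. Qed.

Lemma cmp_move (x y z : D) (r : Hom z y) (l : Hom y z) (f : Hom x y)
  (g : Hom x z) : r ∘ l = idm y -> l ∘ f = g -> f = r ∘ g.
Proof. by move=> rl <-; rewrite cmpA rl cmp_idl. Qed.

Lemma iso_epi (x y z : D) (t : Hom x y) (f g : Hom y z) :
  is_iso t -> f ∘ t = g ∘ t -> f = g.
Proof.
move=> [s [_ ts]] e; rewrite -(cmp_idr f) -(cmp_idr g) -ts.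
by rewrite !cmpA e.
Qed.

Lemma pullback_mono (A B1 B2 P : D) (f : Hom B1 A) (g : Hom B2 A)
  (q1 : Hom P B1) (q2 : Hom P B2) (Q : D) (u w : Hom Q P) :
  is_pullback f g q1 q2 -> q1 ∘ u = q1 ∘ w -> q2 ∘ u = q2 ∘ w -> u = w.
Proof.
move=> [e h] e1 e2; have [|v [_ hv]] := h Q (q1 ∘ w) (q2 ∘ w).
  by rewrite -!cmp_assoc e.
by rewrite -(hv u) // -(hv w).
Qed.

Lemma fpower_mono (A B P : D) (p : Hom B A) n (b : Hom P A)
  (q : 'I_n -> Hom P B) (Q : D) (u w : Hom Q P) :
  is_fpower p b q -> b ∘ u = b ∘ w -> (forall i, q i ∘ u = q i ∘ w) -> u = w.
Proof.
move=> [e h] eb eq; have [i|v [_ hv]] := h Q (b ∘ w) (fun i => q i ∘ w).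
  by rewrite -cmp_assoc e.
by rewrite -(hv u) // -(hv w).
Qed.

Lemma fpower_precomp (A B P P' : D) (p : Hom B A) n (b : Hom P A)
  (q : 'I_n -> Hom P B) (t : Hom P' P) :
  is_iso t -> is_fpower p b q -> is_fpower p (b ∘ t) (fun i => q i ∘ t).
Proof.
move=> [s [st ts]] [e h]; split=> [i|Q v k hk]; first by rewrite -cmp_assoc e.
have [u [[ub uq] uu]] := h Q v k hk; exists (s ∘ u).
split; first split=> [|i].
- by rewrite cmp_assoc -(cmp_assoc t) ts cmp_idl.
- by rewrite cmp_assoc -(cmp_assoc t) ts cmp_idl.
move=> w [wb wq]; rewrite (uu (t ∘ w)); first by rewrite cmpA st cmp_idl.
by split=> [|i]; rewrite cmpA.
Qed.

Lemma fpower_unique (A B P P' : D) (p : Hom B A) n (b : Hom P A)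
  (q : 'I_n -> Hom P B) (b' : Hom P' A) (q' : 'I_n -> Hom P' B) :
  is_fpower p b q -> is_fpower p b' q' ->
  exists t : Hom P P', [/\ is_iso t, b' ∘ t = b & forall i, q' i ∘ t = q i].
Proof.
move=> h h'; have [e hu] := h; have [e' hu'] := h'.
have [t [[tb tq] _]] := hu' P b q e.
have [s [[sb sq] _]] := hu P' b' q' e'.
exists t; split=> //; exists s; split.
  by apply: (fpower_mono h) => [|i]; rewrite cmpA ?sb ?sq ?tb ?tq cmp_idr.
by apply: (fpower_mono h') => [|i]; rewrite cmpA ?tb ?tq ?sb ?sq cmp_idr.
Qed.

Definition two (B P : D) (q1 q2 : Hom P B) (i : 'I_2) : Hom P B :=
  if val i == 0 then q1 else q2.

(** Presents the chosen [tT2] as the case [n = 2] of the general construction of fibre powers. *)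
Lemma fpower_two (A B P : D) (p : Hom B A) (q1 q2 : Hom P B) :
  is_pullback p p q1 q2 -> is_fpower p (p ∘ q1) (two q1 q2).
Proof.
move=> [e h]; split=> [i|Q v k hk]; first by rewrite /two; case: ifP.
have [|u [[u1 u2] uu]] := h Q (k ord0) (k ord_max); first by rewrite !hk.
have k2 i : k i = if val i == 0 then k ord0 else k ord_max.
  by case: i => -[|[|//]] lti; congr k; apply: val_inj.
exists u; split=> [|w [wb wq]]; first split=> [|i].
- by rewrite cmp_assoc u1 hk.
- by rewrite k2 /two; case: ifP.
by apply: uu; split; [have := wq ord0 | have := wq ord_max].
Qed.

(** The condition [Tp ∘ v = z ∘ w] only names [w]: composing with [p], a retraction of [z], gives
    [w = p ∘ Tp ∘ v]. In the same way a cone [(a, b)] over the pullback has [b = p ∘ pT ∘ a]. *)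
Lemma vlift_pullback_equalizer (A TA TTA E : D) (p : Hom TA A)
  (pT Tp : Hom TTA TA) (z : Hom A TA) (v : Hom E TTA) (w : Hom E A) :
  p ∘ z = idm A -> p ∘ Tp = p ∘ pT ->
  is_pullback Tp z v w <-> (is_equalizer Tp (z ∘ p ∘ pT) v /\ Tp ∘ v = z ∘ w).
Proof.
move=> pz pp; split=> [h|[[e h] ew]].
- have [e hu] := h; split=> //; split.
    rewrite !cmp_assoc -(cmp_assoc p) -pp !cmp_assoc e -(cmp_assoc p) pz.
    by rewrite cmp_idl.
  move=> Q a ha; have [|u [[u1 u2] uu]] := hu Q a (p ∘ pT ∘ a).
    by rewrite ha !cmp_assoc.
  exists u; split=> // t ht; apply: uu; split=> //.
  rewrite -ht -cmp_assoc -pp -!cmp_assoc (cmp_assoc p Tp v) e.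
  by rewrite -(cmp_assoc p z w) pz cmp_idl.
- split=> // Q a b hab; have pb : p ∘ pT ∘ a = b.
    by rewrite -cmp_assoc -pp cmp_assoc hab -cmp_assoc pz cmp_idl.
  have [|u [u1 uu]] := h Q a; first by rewrite !cmp_assoc pb.
  exists u; split=> [|t [t1 t2]]; last exact: uu.
  split=> //; rewrite -pb -u1 -cmp_assoc -pp -(cmp_assoc (p ∘ Tp)).
  by rewrite (cmp_assoc p Tp v) ew -(cmp_assoc p z w) pz cmp_idl.
Qed.

(* [cmon_assoc] quantifies over triple powers, and those of [p] in K(X,X) need
   not be pointwise; associativity on generalized elements can be compared. *)
Definition add_assoc (B B2 : D) (q1 q2 add : Hom B2 B) :=
  forall (Q : D) (x y z : Hom Q B) (s s' t t' : Hom Q B2),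
    pairs q1 q2 x y s -> pairs q1 q2 (add ∘ s) z s' ->
    pairs q1 q2 y z t -> pairs q1 q2 x (add ∘ t) t' -> add ∘ s' = add ∘ t'.

Definition add_assoc_at (B B2 P : D) (q1 q2 add : Hom B2 B)
    (q : 'I_3 -> Hom P B) :=
  let x := q (@Ordinal 3 0 isT) in
  let y := q (@Ordinal 3 1 isT) in
  let z := q (@Ordinal 3 2 isT) in
  exists s s' t t' : Hom P B2,
    pairs q1 q2 x y s /\ pairs q1 q2 (add ∘ s) z s' /\
    pairs q1 q2 y z t /\ pairs q1 q2 x (add ∘ t) t' /\
    add ∘ s' = add ∘ t'.

(** Composable elements [x], [y], [z] lie over one map to [A], so they factor through the power by
    some [u]; the four pairings are then those of the universal case composed with [u]. One triple
    power thus suffices for all generalized elements. *)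
Lemma add_assoc_universal (A B B2 P : D) (p : Hom B A) (q1 q2 add : Hom B2 B)
  (b : Hom P A) (q : 'I_3 -> Hom P B) :
  is_pullback p p q1 q2 -> is_fpower p b q ->
  add_assoc_at q1 q2 add q -> add_assoc q1 q2 add.
Proof.
move=> hpb hq [r [r' [k [k' [[r1 r2] [[r1' r2'] [[k1 k2] [[k1' k2'] e]]]]]]]].
move=> Q x y w s s' t t' [s1 s2] [s1' s2'] [t1 t2] [t1' t2'].
have [epb _] := hpb; have [_ hu] := hq.
have pxy : p ∘ x = p ∘ y by rewrite -s1 -s2 -!cmp_assoc epb.
have pyw : p ∘ y = p ∘ w by rewrite -t1 -t2 -!cmp_assoc epb.
pose g (i : 'I_3) := match val i with 0 => x | 1 => y | _ => w end.
have [i|u [[ub uq] _]] := hu Q (p ∘ x) g.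
  by case: i => -[|[|[|//]]] lti; rewrite /g /= -?pyw.
have ux := uq (@Ordinal 3 0 isT); have uy := uq (@Ordinal 3 1 isT).
have uw := uq (@Ordinal 3 2 isT); rewrite /g /= in ux uy uw.
have es : s = r ∘ u.
  by apply: (pullback_mono hpb); rewrite cmpA ?s1 ?s2 ?r1 ?r2.
have es' : s' = r' ∘ u.
  apply: (pullback_mono hpb); rewrite cmpA ?s1' ?s2' ?r1' ?r2' //.
  by rewrite es cmpA.
have et : t = k ∘ u.
  by apply: (pullback_mono hpb); rewrite cmpA ?t1 ?t2 ?k1 ?k2.
have et' : t' = k' ∘ u.
  apply: (pullback_mono hpb); rewrite cmpA ?t1' ?t2' ?k1' ?k2' //.
  by rewrite et cmpA.
by rewrite es' et' !cmpA e.
Qed.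

Lemma add_assoc_fpower (A B B2 P : D) (p : Hom B A) (q1 q2 add : Hom B2 B)
  (b : Hom P A) (q : 'I_3 -> Hom P B) :
  is_pullback p p q1 q2 -> p ∘ add = p ∘ q1 -> add_assoc q1 q2 add ->
  is_fpower p b q -> add_assoc_at q1 q2 add q.
Proof.
move=> [epb hpb] padd hA [e _] x y z.
have [|s [[s1 s2] _]] := hpb P x y; first by rewrite !e.
have [|s' [hs' _]] := hpb P (add ∘ s) z.
  by rewrite -cmp_assoc padd cmp_assoc s1 !e.
have [|t [[t1 t2] _]] := hpb P y z; first by rewrite !e.
have [|t' [ht' _]] := hpb P x (add ∘ t).
  by rewrite -(cmp_assoc p) padd cmp_assoc t1 !e.
exists s, s', t, t'; do !split=> //; first [exact: (proj1 hs') | exact: (proj2 hs')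
  | exact: (proj1 ht') | exact: (proj2 ht') | idtac].
by apply: (hA _ x y z s s' t t').
Qed.

End LimitLemmas.

(** * Preservation of limits by an equivalence of categories *)

Section PreserveLimits.
Variables (D E : Category) (H : Functor D E).
Hypothesis H_full : forall x y (h : Hom (H x) (H y)), exists m, fmap H m = h.
Hypothesis H_faithful : forall x y (m m' : Hom x y), fmap H m = fmap H m' -> m = m'.
Hypothesis H_surj : forall Q : E, exists (R : D) (j : Hom (H R) Q), is_iso j.

Lemma equivalence_pullback (A B1 B2 P : D) (f : Hom B1 A) (g : Hom B2 A)
  (q1 : Hom P B1) (q2 : Hom P B2) :
  is_pullback f g q1 q2 ->
  is_pullback (fmap H f) (fmap H g) (fmap H q1) (fmap H q2).
Proof.
move=> [e h]; split=> [|Q a b hab]; first by rewrite -!fmap_cmp e.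
have [R [j hj]] := H_surj Q; have [i [ij ji]] := hj.
have [a' ea] := H_full (a ∘ j); have [b' eb] := H_full (b ∘ j).
have [|u [[u1 u2] uu]] := h R a' b'.
  by apply: H_faithful; rewrite !fmap_cmp ea eb !cmpA hab.
exists (fmap H u ∘ i); split.
  by split; rewrite cmpA -fmap_cmp ?u1 ?u2 ?ea ?eb cmp_assoc ji cmp_idr.
move=> w [w1 w2]; have [w' ew] := H_full (w ∘ j).
have <- : w' = u.
  by symmetry; apply: uu; split; apply: H_faithful;
    rewrite fmap_cmp ew cmpA ?w1 ?w2.
by rewrite ew cmp_assoc ji cmp_idr.
Qed.

Lemma equivalence_fpower (A B P : D) (p : Hom B A) n (b : Hom P A)
  (q : 'I_n -> Hom P B) :
  is_fpower p b q -> is_fpower (fmap H p) (fmap H b) (fun i => fmap H (q i)).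
Proof.
move=> [e h]; split=> [i|Q v k hk]; first by rewrite -fmap_cmp e.
have [R [j hj]] := H_surj Q; have [i [ij ji]] := hj.
have [v' ev] := H_full (v ∘ j).
have hk' (m : 'I_n) : exists m', fmap H m' = k m ∘ j by apply: H_full.
pose k' m := projT1 (cid (hk' m)).
have ek m : fmap H (k' m) = k m ∘ j by rewrite /k'; case: cid.
have [m|u [[ub uq] uu]] := h R v' k'.
  by apply: H_faithful; rewrite fmap_cmp ev ek cmpA hk.
exists (fmap H u ∘ i); split.
  by split=> [|m]; rewrite cmpA -fmap_cmp ?ub ?uq ?ev ?ek cmp_assoc ji cmp_idr.
move=> w [wb wq]; have [w' ew] := H_full (w ∘ j).
have <- : w' = u.
  by symmetry; apply: uu; split=> [|m]; apply: H_faithful;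
    rewrite fmap_cmp ew cmpA ?wb ?wq ?ev ?ek.
by rewrite ew cmp_assoc ji cmp_idr.
Qed.

End PreserveLimits.

(** * Limits of pseudonatural transformations and the Yoneda embedding *)

Section PointwiseLimits.
Variables (B : Category) (F G : Pseudofunctor (LD B) CAT).
Implicit Types s t P Q : PseudoNat F G.

(** The mediating maps chosen at each component assemble into a modification: naturality and the
    modification axiom are equations between maps into a pullback, so they can be tested on the two
    projections. *)
Lemma pointwise_pullback s0 s1 s2 P (f : Modification s1 s0)
  (g : Modification s2 s0) (q1 : Modification P s1) (q2 : Modification P s2) :
  (forall x a, is_pullback (f x a) (g x a) (q1 x a) (q2 x a)) ->
  @is_pullback (PsNatCat F G) _ _ _ _ f g q1 q2.
Proof.
move=> h; split=> [|Q a b hab]; first by apply: md_ext => x A; have [] := h x A.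
have hab' x A : f x A ∘ a x A = g x A ∘ b x A.
  exact: (congr1 (fun m : Modification Q s0 => m x A) hab).
have hu x A : {u | pairs (q1 x A) (q2 x A) (a x A) (b x A) u}.
  by apply: cid; have [_ /(_ _ _ _ (hab' x A))[u [hu _]]] := h x A; exists u.
pose u x A := sval (hu x A).
have u1 x A : q1 x A ∘ u x A = a x A by exact: (proj1 (svalP (hu x A))).
have u2 x A : q2 x A ∘ u x A = b x A by exact: (proj2 (svalP (hu x A))).
have nu x A A' (k : Hom A A') : u x A' ∘ fmap (Q x) k = fmap (P x) k ∘ u x A.
  apply: (pullback_mono (h x A')); rewrite cmpA ?u1 ?u2 cmpA !ncomp_nat.
    by rewrite -u1 cmp_assoc.
  by rewrite -u2 cmp_assoc.
pose U x : NatTrans (Q x) (P x) := Build_NatTrans (nu x).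
have mU x y (k : Hom x y) A :
    pn_cell P k A ∘ fmap (pfun G k) (U x A) = U y (pfun F k A) ∘ pn_cell Q k A.
  apply: (pullback_mono (h y (pfun F k A))); rewrite !cmpA.
    by rewrite u1 -md_ax cmp_assoc -fmap_cmp u1 -md_ax.
  by rewrite u2 -md_ax cmp_assoc -fmap_cmp u2 -md_ax.
exists (Build_Modification mU); split.
  by split; apply: md_ext => x A; [exact: u1 | exact: u2].
move=> w [w1 w2]; apply: md_ext => x A; apply: (pullback_mono (h x A)).
  by rewrite u1 -w1.
by rewrite u2 -w2.
Qed.

Lemma pointwise_fpower s0 s1 P (p : Modification s1 s0) n
  (b : Modification P s0) (q : 'I_n -> Modification P s1) :
  (forall x a, is_fpower (p x a) (b x a) (fun i => q i x a)) ->
  @is_fpower (PsNatCat F G) _ _ p n P b q.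
Proof.
move=> h; split=> [i|Q v k hk].
  by apply: md_ext => x A; have [e _] := h x A; exact: e.
have hk' x A i : p x A ∘ k i x A = v x A.
  exact: (congr1 (fun m : Modification Q s0 => m x A) (hk i)).
have hu x A : {u | b x A ∘ u = v x A /\ forall i, q i x A ∘ u = k i x A}.
  by apply: cid; have [_ /(_ _ _ _ (hk' x A))[u [hu _]]] := h x A; exists u.
pose u x A := sval (hu x A).
have ub x A : b x A ∘ u x A = v x A by exact: (proj1 (svalP (hu x A))).
have uq x A i : q i x A ∘ u x A = k i x A by exact: (proj2 (svalP (hu x A))).
have nu x A A' (r : Hom A A') : u x A' ∘ fmap (Q x) r = fmap (P x) r ∘ u x A.
  apply: (fpower_mono (h x A')) => [|i]; rewrite cmpA ?ub ?uq cmpA !ncomp_nat.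
    by rewrite -ub cmp_assoc.
  by rewrite -uq cmp_assoc.
pose U x : NatTrans (Q x) (P x) := Build_NatTrans (nu x).
have mU x y (r : Hom x y) A :
    pn_cell P r A ∘ fmap (pfun G r) (U x A) = U y (pfun F r A) ∘ pn_cell Q r A.
  apply: (fpower_mono (h y (pfun F r A))) => [|i]; rewrite !cmpA.
    by rewrite ub -md_ax cmp_assoc -fmap_cmp ub -md_ax.
  by rewrite uq -md_ax cmp_assoc -fmap_cmp uq -md_ax.
exists (Build_Modification mU); split.
  by split=> [|i]; apply: md_ext => x A; [exact: ub | exact: uq].
move=> w [wb wq]; apply: md_ext => x A; apply: (fpower_mono (h x A)) => [|i].
  by rewrite ub -wb.
by rewrite uq -wq.
Qed.

End PointwiseLimits.

(** * The Yoneda lemma for [CAT]-valued pseudofunctors *)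

Section Yoneda.
Variable B : Category.

(** Serves the normality of [yo]: [idm z ∘ h = h] is only a propositional equality, so the two
    functors agree on objects up to [cell_of_eq]. *)
Lemma functor_ext_eq (D E : Category) (H K : Functor D E)
  (e : forall x, H x = K x) :
  (forall x y (f : Hom x y),
     fmap K f ∘ cell_of_eq (e x) = cell_of_eq (e y) ∘ fmap H f) -> H = K.
Proof.
case: H K e => [Ho Hm Hi Hc] [Ko Km Ki Kc] /= e.
have eo : Ho = Ko by apply: functional_extensionality_dep.
subst Ko => he; have em : Hm = Km.
  apply: functional_extensionality_dep => x.
  apply: functional_extensionality_dep => y.
  apply: functional_extensionality_dep => f.
  have := he x y f; rewrite (Prop_irrelevance (e x) erefl).
  by rewrite (Prop_irrelevance (e y) erefl) /= cmp_idl cmp_idr.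
by subst Km; congr Build_Functor; apply: Prop_irrelevance.
Qed.

Variable x : B.

Lemma disc_irr (A : Type) (a b : Disc A) (e e' : Hom a b) : e = e'.
Proof. exact: (@Prop_irrelevance (a = b)). Qed.

Definition yo_map (z w : B) (f : Hom z w) :
  Functor (Disc (@Hom B x z)) (Disc (@Hom B x w)).
Proof.
refine {| fobj := fun h : Disc (@Hom B x z) => (f ∘ h) : Disc (@Hom B x w);
  fmap := fun h h' e => congr1 (cmp f) e |}; by move=> *; exact: disc_irr.
Defined.

Definition disc_nat (D : Category) (A : Type) (H K : Functor D (Disc A))
  (e : forall h, H h = K h) : NatTrans H K := {|
  ncomp := fun h => e h : @Hom (Disc A) (H h) (K h);
  ncomp_nat := fun h h' k => disc_irr _ _ |}.

(** The representable B(x,-), with hom-sets as discrete categories. Its coherence laws are equations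
    between proofs; normality asks for an equality of functors. *)
Definition yo : Pseudofunctor (LD B) CAT.
Proof.
refine {|
  pob := (fun z => Disc (@Hom B x z)) : LD B -> CAT;
  pmap := fun z w f => yo_map f : @bhom CAT _ _;
  pmap2 := fun z w f g (e : f = g) =>
    disc_nat (H := yo_map f) (K := yo_map g) (fun h => congr1 (fun k => k ∘ h) e);
  pcmp := fun z w v g f =>
    disc_nat (H := fcmp (yo_map g) (yo_map f)) (K := yo_map (g ∘ f))
      (fun h => esym (cmp_assoc g f h));
  punit := fun z => disc_nat (H := fid _) (K := yo_map (idm z))
      (fun h => esym (cmp_idl h)) |}.
- by move=> *; apply: nat_ext => h; exact: disc_irr.
- by move=> *; apply: nat_ext => h; exact: disc_irr.
- move=> z w v g f.
  exists (disc_nat (H := yo_map (g ∘ f)) (K := fcmp (yo_map g) (yo_map f))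
            (fun h => cmp_assoc g f h)).
  by split; apply: nat_ext => h; exact: disc_irr.
- by move=> *; apply: nat_ext => h; exact: disc_irr.
- by move=> *; apply: nat_ext => h; exact: disc_irr.
- by move=> *; apply: nat_ext => h; exact: disc_irr.
- by move=> *; apply: nat_ext => h; exact: disc_irr.
- by move=> *; apply: nat_ext => h; exact: disc_irr.
- move=> z; unshelve eexists; last first.
    by apply: nat_ext => h; exact: disc_irr.
  apply: functor_ext_eq => /=; first by move=> h; rewrite cmp_idl.
  by move=> *; exact: disc_irr.
Defined.

Variable F : Pseudofunctor (LD B) CAT.

(** The coherence laws of [F] contain [pmap2] of an associativity or unit equation on one side,
    those of [yo_elt] need the converse equation on the other; this inverse moves it across. *)
Lemma pmap2K (A : pcat F x) (z : B) (h h' : Hom x z) (e : h = h') :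
  (@pmap2 _ _ F x z h' h (esym e) : NatTrans (pfun F h') (pfun F h)) A ∘
  (@pmap2 _ _ F x z h h' e : NatTrans (pfun F h) (pfun F h')) A =
  idm (pfun F h A).
Proof.
case: _ / e; have := congr1 (fun t : NatTrans _ _ => t A) (@pmap2_id _ _ F x z h).
by move=> /= ->; rewrite cmp_idl.
Qed.

Definition yo_elt_fun (A : pcat F x) (z : B) : Functor (pcat yo z) (pcat F z).
Proof.
refine {|
  fobj := fun h : pcat yo z => pfun F (h : Hom x z) A;
  fmap := fun h h' (e : h = h') =>
    (@pmap2 _ _ F x z h h' e : NatTrans (pfun F h) (pfun F h')) A |}.
- move=> h.
  exact: (congr1 (fun t : NatTrans _ _ => t A) (@pmap2_id _ _ F x z h)).
- move=> h h' h'' e e'.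
  exact: (congr1 (fun t : NatTrans _ _ => t A) (@pmap2_cmp _ _ F x z _ _ _ e e')).
Defined.

Definition yo_elt_cell (A : pcat F x) (y z : B) (f : Hom y z) :
  NatTrans (fcmp (pfun F f) (yo_elt_fun A y)) (fcmp (yo_elt_fun A z) (pfun yo f)).
Proof.
refine (@Build_NatTrans _ _ (fcmp (pfun F f) (yo_elt_fun A y))
  (fcmp (yo_elt_fun A z) (pfun yo f))
  (fun h : pcat yo y => pfun_cmp F f (h : Hom x y) A) _).
move=> h h' e.
exact: (congr1 (fun t : NatTrans _ _ => t A)
          (@pcmp_lwhisk _ _ F x y z f h h' e)).
Defined.

(** The transformation that the Yoneda lemma attaches to [A]; its two laws are the associativity and
    left unit laws of [F] read at [A]. *)
Definition yo_elt (A : pcat F x) : PseudoNat yo F.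
Proof.
refine {| pn := yo_elt_fun A; pn_cell := yo_elt_cell A |}.
- move=> y z f h; have [g [g1 g2]] := @pcmp_iso _ _ F x y z f h.
  exists ((g : NatTrans _ _) A); split.
    exact: (congr1 (fun t : NatTrans _ _ => t A) g1).
  exact: (congr1 (fun t : NatTrans _ _ => t A) g2).
- move=> y z w g f h /=.
  have := congr1 (fun t : NatTrans _ _ => t A) (@pcmp_assoc _ _ F x y z w g f h).
  rewrite /= cmp_idr => e.
  exact: (cmp_move (pmap2K A (cmp_assoc g f h)) e).
- move=> z h /=.
  have e := congr1 (fun t : NatTrans _ _ => t A) (@pcmp_lunit _ _ F x z h).
  by have := cmp_move (pmap2K A (cmp_idl h)) e; rewrite cmp_idr; exact.
Defined.

Definition yo_eval : Functor (PsNatCat yo F) (pcat F x) := {|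
  fobj := fun s : PsNatCat yo F => (s : PseudoNat yo F) x (idm x : pcat yo x);
  fmap := fun (s t : PsNatCat yo F) (m : Hom s t) =>
    (m : Modification s t) x (idm x : pcat yo x);
  fmap_id := fun s => erefl;
  fmap_cmp := fun s t u m n => erefl |}.

(** The modification axiom at [h] and the identity of [x] expresses the component at [h ∘ idm x]
    through the one at the identity, because the cell of [s] is invertible. *)
Lemma yo_eval_faithful (s t : PsNatCat yo F) (m m' : Hom s t) :
  fmap yo_eval m = fmap yo_eval m' -> m = m'.
Proof.
move: m m' => /= m m' e; apply: md_ext => z h.
rewrite -(cmp_idr (h : Hom x z)); apply: (iso_epi (pn_iso s h (idm x))).
have := md_ax m h (idm x : pcat yo x); have := md_ax m' h (idm x : pcat yo x).
by rewrite /= => <- <-; rewrite e.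
Qed.

Lemma yo_eval_full (s t : PsNatCat yo F) (k : Hom (yo_eval s) (yo_eval t)) :
  exists m, fmap yo_eval m = k.
Proof.
move: s t k => /= s t k.
pose r (z : B) (h : Hom x z) : @Hom (pcat yo z) (h ∘ idm x) h := cmp_idr h.
pose r' (z : B) (h : Hom x z) : @Hom (pcat yo z) h (h ∘ idm x) :=
  esym (cmp_idr h).
have rr' z h (u : PseudoNat yo F) :
    fmap (u z) (r z h) ∘ fmap (u z) (r' z h) = idm _.
  by rewrite -fmap_cmp -fmap_id; congr fmap; apply: disc_irr.
have r'r z h (u : PseudoNat yo F) :
    fmap (u z) (r' z h) ∘ fmap (u z) (r z h) = idm _.
  by rewrite -fmap_cmp -fmap_id; congr fmap; apply: disc_irr.
have hi (z : B) (h : Hom x z) := pn_iso s h (idm x : pcat yo x).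
pose i z h := sval (cid (hi z h)).
have ic z h : i z h ∘ pn_cell s h (idm x) = idm _.
  by rewrite /i; case: cid => ? [].
(* The modification axiom at the identity forces the value at [h ∘ idm x]; [r] and [r'] carry it to
   [h], which is equal to [h ∘ idm x] only propositionally. *)
pose m (z : B) (h : Hom x z) : Hom (s z h) (t z h) :=
  fmap (t z) (r z h) ∘
    (pn_cell t h (idm x : pcat yo x) ∘ fmap (pfun F h) k ∘ i z h) ∘
    fmap (s z) (r' z h).
have nm z (h h' : Hom x z) (e : @Hom (pcat yo z) h h') :
    m z h' ∘ fmap (s z) e = fmap (t z) e ∘ m z h.
  refine (match e as e0 in (_ = g)
    return m z g ∘ fmap (s z) (e0 : @Hom (pcat yo z) h g) =
           fmap (t z) (e0 : @Hom (pcat yo z) h g) ∘ m z h with erefl => _ end).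
  by rewrite (fmap_id (s z)) (fmap_id (t z)) cmp_idl cmp_idr.
have mE z (h : Hom x z) : m z (h ∘ idm x) ∘ pn_cell s h (idm x : pcat yo x) =
    pn_cell t h (idm x : pcat yo x) ∘ fmap (pfun F h) k.
  rewrite -[LHS]cmp_idl -(r'r z h t) cmp_assoc.
  rewrite -(cmp_assoc (fmap (t z) (r z h))) -nm /m.
  rewrite !cmp_assoc -(cmp_assoc (fmap (s z) (r' z h))) r'r cmp_idl ic.
  rewrite (cmp_idr (fmap (pfun F h) k)).
  by rewrite -cmp_assoc r'r cmp_idl.
clearbody m.
pose M z : NatTrans (s z) (t z) :=
  @Build_NatTrans _ _ (s z) (t z) (m z) (nm z).
have mM y z (f : Hom y z) (h : pcat yo y) :
    pn_cell t f h ∘ fmap (pfun F f) (M y h) = M z (pfun yo f h) ∘ pn_cell s f h.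
  suff : pn_cell t f ((h : Hom x y) ∘ idm x : pcat yo y) ∘
           fmap (pfun F f) (M y ((h : Hom x y) ∘ idm x)) =
         M z (pfun yo f ((h : Hom x y) ∘ idm x : pcat yo y)) ∘
           pn_cell s f ((h : Hom x y) ∘ idm x : pcat yo y).
    by rewrite cmp_idr.
  have hs := pn_iso s (h : Hom x y) (idm x : pcat yo x).
  (* After precomposition with the image of the invertible cell of [s] at [h], [pn_cmp] merges the
     cells of [h] and [f] into that of [f ∘ h], to which [mE] applies up to the reassociation
     [a]. *)
  apply: (iso_epi (is_iso_fmap (pfun F f) hs)).
  rewrite !cmp_assoc -fmap_cmp mE.
  pose a : @Hom (pcat yo z) (f ∘ (h ∘ idm x)) ((f ∘ h) ∘ idm x) :=
    esym (cmp_assoc f h (idm x)).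
  pose a' : @Hom (pcat yo z) ((f ∘ h) ∘ idm x) (f ∘ (h ∘ idm x)) :=
    cmp_assoc f h (idm x).
  have a'a (u : PseudoNat yo F) : fmap (u z) a' ∘ fmap (u z) a = idm _.
    by rewrite -fmap_cmp -fmap_id; congr fmap; apply: disc_irr.
  have es := pn_cmp s f (h : Hom x y) (idm x : pcat yo x).
  have et := pn_cmp t f (h : Hom x y) (idm x : pcat yo x).
  rewrite -[LHS]cmp_idl -[RHS]cmp_idl -(a'a t) !(cmp_assoc (fmap (t z) a')).
  congr (_ ∘ _).
  rewrite /=; have := nm _ _ _ a; rewrite /= => e.
  rewrite -(cmp_assoc _ (m z _)) -[X in _ = X ∘ _]e.
  rewrite (cmp_assoc (m z _) (fmap (s z) a)) -[X in _ = _ ∘ X]es.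
  rewrite -(cmp_assoc (m z _) (pn_cell s (f ∘ h) _)) mE fmap_cmp.
  rewrite (cmp_assoc _ (fmap (pfun F (f ∘ h)) k)).
  have := ncomp_nat (pfun_cmp F f h) k; rewrite /= => <-.
  rewrite -(cmp_assoc _ (pfun_cmp F f h _)) [X in _ = X ∘ _]et.
  by rewrite !(cmp_assoc (fmap (t z) _)) !(cmp_assoc (pn_cell t f _)).
exists (Build_Modification mM) => /=.
pose o : pcat yo x := idm x.
have us := pn_unit s o; have ut := pn_unit t o.
have e1 : fmap (s x) (pfun_unit yo x o) = fmap (s x) (r' x (idm x)).
  by congr fmap; apply: disc_irr.
have e2 : fmap (t x) (pfun_unit yo x o) = fmap (t x) (r' x (idm x)).
  by congr fmap; apply: disc_irr.
(* At the identity, [r'] is the unit cell of [yo], so [pn_unit] for [s] and [t] with [mE] turns the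
   component into [k], up to naturality of the unit of [F]. *)
rewrite -[LHS]cmp_idl -[RHS]cmp_idl -(rr' x (idm x) t) !cmp_assoc.
congr (_ ∘ _); rewrite -nm -e1 -us -e2 -ut cmpA mE !cmp_assoc; congr (_ ∘ _).
exact: (esym (ncomp_nat (pfun_unit F x) k)).
Qed.

Lemma pnormal_fun : fid (pcat F x) = pfun F (idm x).
Proof. by have [] := pnormal F x. Qed.

Lemma yo_eval_surj (Q : pcat F x) :
  exists (R : PsNatCat yo F) (j : Hom (yo_eval R) Q), is_iso j.
Proof.
exists (yo_elt Q) => /=; rewrite -pnormal_fun; exists (idm Q); exact: is_iso_id.
Qed.

End Yoneda.

(** * From tangent objects to tangent-valued pseudofunctors *)

Section YonedaLimits.
Variables (B : Category) (F G : Pseudofunctor (LD B) CAT).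

(** Precomposing with [yo_elt A] and evaluating at the identity of [x] reads off the component at
    [pfun F (idm x) A], which normality replaces by [A]. *)
Lemma precomp_pullback (s0 s1 s2 P : PseudoNat F G) (f : Modification s1 s0)
  (g : Modification s2 s0) (q1 : Modification P s1) (q2 : Modification P s2) :
  (forall (F' : Pseudofunctor (LD B) CAT) (k : PseudoNat F' F),
     @is_pullback (PsNatCat F' G) _ _ _ _ (md_rwhisk f k) (md_rwhisk g k)
       (md_rwhisk q1 k) (md_rwhisk q2 k)) ->
  forall x A, is_pullback (f x A) (g x A) (q1 x A) (q2 x A).
Proof.
move=> h x A.
have := equivalence_pullback (@yo_eval_full _ x G) (@yo_eval_faithful _ x G)
  (@yo_eval_surj _ x G) (h _ (yo_elt A)).
by rewrite /= -(pnormal_fun x F).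
Qed.

Lemma precomp_fpower (s0 s1 P : PseudoNat F G) (p : Modification s1 s0) n
  (b : Modification P s0) (q : 'I_n -> Modification P s1) :
  (forall (F' : Pseudofunctor (LD B) CAT) (k : PseudoNat F' F),
     @is_fpower (PsNatCat F' G) _ _ (md_rwhisk p k) n _ (md_rwhisk b k)
       (fun i => md_rwhisk (q i) k)) ->
  forall x A, is_fpower (p x A) (b x A) (fun i => q i x A).
Proof.
move=> h x A.
have := equivalence_fpower (@yo_eval_full _ x G) (@yo_eval_faithful _ x G)
  (@yo_eval_surj _ x G) (h _ (yo_elt A)).
by rewrite /= -(pnormal_fun x F).
Qed.

End YonedaLimits.

Lemma bpow_fpow (B : Category) (F : BICAT B) (T : bhom F F) (m : nat) (x : B) :
  pn (bpow T m : PseudoNat F F) x = fpow (pn (T : PseudoNat F F) x) m.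
Proof. by elim: m => //= m ->. Qed.

(** [is_vlift] hides a map into [T (T2 A)]; its two projections determine it because [T] preserves
    the pullback [T2 A], the case [m = 1] of [tan_T2]. *)
Lemma vlift_unique (D : Category) (e : TangentData D) (A : D)
  (v v' : Hom (tT2 e A) (tT e (tT e A))) :
  is_tangent e -> is_vlift v -> is_vlift v' -> v = v'.
Proof.
move=> ht [u [[u1 u2] ->]] [u' [[u1' u2'] ->]]; congr (_ ∘ _).
by apply: (pullback_mono (tan_T2 ht A 1)); rewrite /= ?u1 ?u2.
Qed.

Lemma tan_cell_iso (D E : TangentCat) (H K : StrongCat D E) (r : Hom H K) :
  (forall A, is_iso (tcell r A)) -> is_iso r.
Proof.
move=> h; pose s A := sval (cid (h A)).
have sr A : s A ∘ tcell r A = idm _ by rewrite /s; case: cid => ? [].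
have rs A : tcell r A ∘ s A = idm _ by rewrite /s; case: cid => ? [].
have ns A A' (k : Hom A A') : s A' ∘ fmap (sfun K) k = fmap (sfun H) k ∘ s A.
  apply: (iso_epi (h A)); rewrite !cmp_assoc sr cmp_idr -ncomp_nat cmpA sr.
  by rewrite cmp_idl.
pose S : NatTrans (sfun K) (sfun H) := Build_NatTrans ns.
have tS A :
    fmap (tT (tdata E)) (S A) ∘ scell K A = scell H A ∘ S (tT (tdata D) A).
  apply: (iso_epi (h (tT (tdata D) A))).
  rewrite !cmp_assoc sr cmp_idr -(tcell_ax r) cmpA -fmap_cmp sr.
  by rewrite fmap_id cmp_idl.
exists (@Build_TanCell _ _ K H S tS); split; apply: tcell_ext => A.
  exact: sr.
exact: rs.
Qed.

(** Normality of the underlying functor lifts to tangent morphisms: once [u] is an identity, its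
    compatibility with the tangent cells forces the cell of [H] to be that of [sm_id D], and only a
    proof is left to identify. *)
Lemma tan_normal (D : TangentCat) (H : StrongMor D D) (u : TanCell (sm_id D) H)
  (e : fid D = sfun H) :
  tcell u = @cell_of_eq (FunCat D D) _ _ e ->
  exists e' : sm_id D = H, u = @cell_of_eq (StrongCat D D) _ _ e'.
Proof.
case: H u e => H alpha ax' [u hu] /= e; case: H / e alpha ax' u hu.
move=> alpha ax' u /= hu eu; subst u.
have ea : scell (sm_id D) = alpha.
  apply: nat_ext => A; have := hu A; rewrite /= fmap_id !cmp_idl => e.
  exact: (etrans e (cmp_idr _)).
case: alpha / ea ax' hu => ax' hu.
have e' : sm_id D = @Build_StrongMor D D (fid D) (scell (sm_id D)) ax'.
  by rewrite (Prop_irrelevance ax' (strong_ax (sm_id D))).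
exists e'; apply: tcell_ext => A /=.
have : forall (K : StrongMor D D) (w : sm_id D = K),
    tcell (@cell_of_eq (StrongCat D D) _ _ w) A =
    (match w in _ = z return Hom A (sfun z A) with erefl => idm A end).
  by move=> K w; destruct w.
move=> ->; move: e'; rewrite (Prop_irrelevance ax' (strong_ax (sm_id D))) => e'.
by rewrite (Prop_irrelevance e' erefl).
Qed.

(** * The tangent categories F x and the strong morphisms F f *)

Section TangentObjectPointwise.
Variables (B : Category) (X : TangentObject (BICAT B)).
Local Notation F := (tobj_psf X).
Local Notation d := (tobj_data X).
Local Notation T := (tobj_T X).
Local Notation T2 := (tobj_T2 X).

Let p : Modification T (pn_id F) := opr d.
Let zr : Modification (pn_id F) T := oz d.
Let pi1 : Modification T2 T := opi1 d.
Let pi2 : Modification T2 T := opi2 d.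
Let add : Modification T2 T := oadd d.
Let l : Modification T (pn_comp T T) := ol d.
Let c : Modification (pn_comp T T) (pn_comp T T) := oc d.
Let ax := tobj_ax X.

Lemma tobj_T2_at (x : B) (A : pcat F x) (m : nat) :
  is_pullback (fmap (fpow (T x) m) (p x A)) (fmap (fpow (T x) m) (p x A))
    (fmap (fpow (T x) m) (pi1 x A)) (fmap (fpow (T x) m) (pi2 x A)).
Proof.
have := precomp_pullback (tob_T2_pointwise ax m) A.
by rewrite /= bpow_fpow.
Qed.

(** The power [P] is chosen before [m], [x] and [A]: its cells relate the powers in different
    fibres, which is how [F f] is shown to preserve them. *)
Lemma tobj_powers_at (n : nat) :
  exists (P : PseudoNat F F) (b : Modification P (pn_id F))
    (q : 'I_n -> Modification P T),
    forall (m : nat) (x : B) (A : pcat F x),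
      is_fpower (fmap (fpow (T x) m) (p x A)) (fmap (fpow (T x) m) (b x A))
        (fun i => fmap (fpow (T x) m) (q i x A)).
Proof.
have [P [b [q [_ h]]]] := tob_powers ax n.
exists P, b, q => m x A; have := precomp_fpower (h m) A.
by rewrite /= bpow_fpow.
Qed.

Let at_eq (s t : PseudoNat F F) (m n : Modification s t) (x : B) (A : pcat F x) :
  m = n -> m x A = n x A.
Proof. by move=> ->. Qed.

(** Associativity in the hom-category is applied to a triple power that is also pointwise, so that
    its component at [A] is universal among composable triples over [A]. *)
Lemma tobj_add_assoc (x : B) (A : pcat F x) :
  add_assoc (pi1 x A) (pi2 x A) (add x A).
Proof.
have [P [b [q hP]]] := tobj_powers_at 3.
have hq : @is_fpower (PsNatCat F F) _ _ p 3 P b q.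
  by apply: pointwise_fpower => y a; have := hP 0 y a.
have hA := hP 0 x A; rewrite /= in hA.
have hpb := tobj_T2_at A 0; rewrite /= in hpb.
apply: (add_assoc_universal hpb hA).
have [r [r' [k [k' [[r1 r2] [[r1' r2'] [[k1 k2] [[k1' k2'] e]]]]]]]] :=
  cmon_assoc (tob_cmonoid ax) hq.
exists ((r : Modification P T2) x A), ((r' : Modification P T2) x A),
  ((k : Modification P T2) x A), ((k' : Modification P T2) x A).
by do !split; [exact: (at_eq A r1) | exact: (at_eq A r2)
  | exact: (at_eq A r1') | exact: (at_eq A r2') | exact: (at_eq A k1)
  | exact: (at_eq A k2) | exact: (at_eq A k1') | exact: (at_eq A k2')
  | exact: (at_eq A e)].
Qed.

(** A single modification [v] serves all [x] and [A], so that its axiom at [f] can be used when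
    [F f] is shown to preserve the equalizers. *)
Lemma tobj_vlift : exists v : Modification T2 (pn_comp T T),
  forall (x : B) (A : pcat F x), is_vlift (d := tobj_at X x) (v x A) /\
    is_equalizer (fmap (T x) (p x A)) (zr x A ∘ p x A ∘ p x (T x A)) (v x A).
Proof.
have [u [[u1 u2] [_ hu]]] := tob_vlift ax.
exists (md_cmp (md_lwhisk T add) (u : Modification T2 (pn_comp T T2))) => x A.
split.
  exists ((u : Modification T2 (pn_comp T T2)) x A); split=> //.
  split; first exact: (at_eq A u1).
  by have := at_eq A u2; rewrite /= cmp_idr.
have := precomp_pullback hu A; rewrite /= cmp_idl.
move/vlift_pullback_equalizer => h.
have [||hE _] := h (p x A) (p x ((T x) A)); last exact: hE.
  exact: (at_eq A (cmon_zero_over (tob_cmonoid ax))).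
exact: (ncomp_nat (p x) (p x A)).
Qed.

Lemma tobj_at_tangent (x : B) : is_tangent (tobj_at X x).
Proof.
split=> /= A.
- move=> m; exact: tobj_T2_at.
- move=> n; have [P [b [q h]]] := tobj_powers_at n.
  exists (P x A), (b x A), (fun i => q i x A); split; first exact: (h 0 x A).
  by move=> m; exact: h.
- have hpb := tobj_T2_at A 0; rewrite /= in hpb.
  have m := tob_cmonoid ax; split.
  + exact: (at_eq A (cmon_add_over m)).
  + exact: (at_eq A (cmon_zero_over m)).
  + have [u [[u1 u2] u3]] := cmon_unit m.
    exists ((u : Modification T T2) x A); split; last exact: (at_eq A u3).
    by split; [exact: (at_eq A u1) | exact: (at_eq A u2)].
  + have [u [[u1 u2] u3]] := cmon_comm m.
    exists ((u : Modification T2 T2) x A); split; last exact: (at_eq A u3).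
    by split; [exact: (at_eq A u1) | exact: (at_eq A u2)].
  + move=> P b q hq; apply: (add_assoc_fpower hpb _ (@tobj_add_assoc x A) hq).
    exact: (at_eq A (cmon_add_over m)).
- by have := at_eq A (tob_l_p ax); rewrite /= cmp_idl.
- have [u [[u1 u2] u3]] := tob_l_add ax.
  exists ((u : Modification T2 (pn_comp T T2)) x A).
  split; last exact: (at_eq A u3).
  by split; [exact: (at_eq A u1) | exact: (at_eq A u2)].
- by have := at_eq A (tob_l_zero ax); rewrite /= cmp_idr.
- by have := at_eq A (tob_c_p ax); rewrite /= !cmp_idl.
- have [u [[u1 u2] u3]] := tob_c_add ax.
  exists ((u : Modification (pn_comp T T2) (pn_comp T2 T)) x A).
  split; last exact: (at_eq A u3).
  by split; [exact: (at_eq A u1) | exact: (at_eq A u2)].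
- by have := at_eq A (tob_c_zero ax); rewrite /= !cmp_idr.
- exact: (at_eq A (tob_c_c ax)).
- exact: (at_eq A (tob_c_l ax)).
- by have := at_eq A (tob_l_l ax); rewrite /= !cmp_idl.
- by have := at_eq A (tob_yang_baxter ax); rewrite /= !cmp_idl !cmp_idr.
- by have := at_eq A (tob_c_c_l ax); rewrite /= !cmp_idl !cmp_idr.
- by have [v hv] := tobj_vlift; exists (v x A).
Qed.

Lemma tobj_mor_strong (x y : B) (f : Hom x y) :
  is_strong (dD := tobj_at X x) (dE := tobj_at X y) (pn_cell T f).
Proof.
split=> /= A.
- move=> n P b q hq.
  (* Any power of [p x A] is isomorphic to the component of the pseudonatural power [P']; the
     invertible cell of [P'] at [f] identifies the image of that component with the power over
     [pfun F f A]. *)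
  have [P' [b' [q' h]]] := tobj_powers_at n.
  have hx := h 0 x A; have hy := h 0 y (pfun F f A); rewrite /= in hx hy.
  have [t [ht <- tq]] := fpower_unique hq hx.
  have -> : q = fun i => q' i x A ∘ t.
    by apply: functional_extensionality_dep => i; rewrite tq.
  rewrite fmap_cmp.
  have -> : (fun i => fmap (pfun F f) (q' i x A ∘ t)) =
            (fun i => fmap (pfun F f) (q' i x A) ∘ fmap (pfun F f) t).
    by apply: functional_extensionality_dep => i; rewrite fmap_cmp.
  apply: fpower_precomp; first exact: is_iso_fmap.
  have hp : p y (pfun F f A) ∘ pn_cell T f A = fmap (pfun F f) (p x A).
    by have := md_ax p f A; rewrite /= !cmp_idl.
  apply/(is_fpower_iso _ _ (pn_iso T f A) hp).
  have := fpower_precomp (pn_iso P' f A) hy.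
  have := md_ax b' f A; rewrite /= !cmp_idl => <-.
  by congr is_fpower; apply: functional_extensionality_dep => i; rewrite md_ax.
(* As for powers: the cells of [T2] and of [T] composed with itself are invertible and identify the
   image of [v' x A] with [v'] at [pfun F f A]. *)
- move=> v hv; have [v' hv'] := tobj_vlift.
  rewrite (vlift_unique (@tobj_at_tangent x) hv (proj1 (hv' x A))).
  have iTT := pn_iso (pn_comp T T) f A.
  apply/(is_equalizer_iso (f' := fmap (T y) (p y (pfun F f A)))
    (g' := zr y (pfun F f A) ∘ p y (pfun F f A) ∘ p y (T y (pfun F f A)))
    _ iTT (pn_iso T f A)).
  + have := md_ax (md_lwhisk T p) f A.
    by rewrite /= !cmp_idl fmap_id cmp_idl => e; exact: (esym e).
  + have := md_ax (md_cmp zr (md_cmp p (md_cmp (md_lunit T) (md_rwhisk p T)))) f A.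
    by rewrite /= !cmp_idl => e; exact: (esym e).
  rewrite [X in is_equalizer _ _ X](md_ax v' f A).
  apply: is_equalizer_precomp; first exact: pn_iso.
  exact: (proj2 (hv' y (pfun F f A))).
- exact: pn_iso.
- by have := md_ax p f A; rewrite /= !cmp_idl.
- by have := md_ax zr f A; rewrite /= !cmp_idl cmp_idr.
- exists (pn_cell T2 f A); split; last exact: (md_ax add f A).
  by split; rewrite -md_ax.
- by have := md_ax l f A; rewrite /= cmp_assoc.
- by have := md_ax c f A; rewrite /= !cmp_assoc.
Qed.

Definition tobj_cat (x : B) : TangentCat := Build_TangentCat (tobj_at_tangent x).

Definition tobj_strong (x y : B) (f : Hom x y) :
  StrongMor (tobj_cat x) (tobj_cat y) :=
  @Build_StrongMor (tobj_cat x) (tobj_cat y) (pfun F f) (pn_cell T f)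
    (tobj_mor_strong f).

Definition tobj_map2 (x y : B) (f g : Hom x y) (e : f = g) :
  TanCell (tobj_strong f) (tobj_strong g).
Proof.
refine (@Build_TanCell _ _ (tobj_strong f) (tobj_strong g)
  (@pmap2 _ _ F x y f g e) _).
move=> A /=; case: _ / e; rewrite -/(idm (f : @bhom (LD B) x y)) pmap2_id /=.
by rewrite fmap_id cmp_idl cmp_idr.
Defined.

(** The coherence laws of the pseudonatural transformation [T] are, read backwards, the conditions
    for the coherence cells of [F] to be 2-cells of tangent morphisms. *)
Definition tobj_cmp (x y z : B) (g : Hom y z) (f : Hom x y) :
  TanCell (sm_cmp (tobj_strong g) (tobj_strong f)) (tobj_strong (g ∘ f)).
Proof.
refine (@Build_TanCell _ _ (sm_cmp (tobj_strong g) (tobj_strong f))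
  (tobj_strong (g ∘ f)) (pfun_cmp F g f) _).
by move=> A /=; exact: (esym (pn_cmp T g f A)).
Defined.

Definition tobj_unit (x : B) : TanCell (sm_id (tobj_cat x)) (tobj_strong (idm x)).
Proof.
refine (@Build_TanCell _ _ (sm_id (tobj_cat x)) (tobj_strong (idm x))
  (pfun_unit F x) _).
by move=> A /=; rewrite !cmp_idl cmp_idr; exact: (esym (pn_unit T A)).
Defined.

Definition tobj_tan : Pseudofunctor (LD B) TAN.
Proof.
refine (@Build_Pseudofunctor (LD B) TAN tobj_cat tobj_strong tobj_map2 tobj_cmp
  tobj_unit _ _ _ _ _ _ _ _ _).
- move=> x y f; apply: tcell_ext => A.
  exact: (congr1 (fun t : NatTrans _ _ => t A) (@pmap2_id _ _ F x y f)).
- move=> x y f g h b a; apply: tcell_ext => A.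
  exact: (congr1 (fun t : NatTrans _ _ => t A) (@pmap2_cmp _ _ F x y _ _ _ b a)).
- move=> x y z g f; apply: tan_cell_iso => A.
  have [s [s1 s2]] := @pcmp_iso _ _ F x y z g f.
  exists ((s : NatTrans _ _) A); split.
    exact: (congr1 (fun t : NatTrans _ _ => t A) s1).
  exact: (congr1 (fun t : NatTrans _ _ => t A) s2).
- move=> x y z g f f' a; apply: tcell_ext => A.
  exact: (congr1 (fun t : NatTrans _ _ => t A) (@pcmp_lwhisk _ _ F x y z g _ _ a)).
- move=> x y z g g' b f; apply: tcell_ext => A.
  exact: (congr1 (fun t : NatTrans _ _ => t A) (@pcmp_rwhisk _ _ F x y z _ _ b f)).
- move=> x y z w h g f; apply: tcell_ext => A.
  exact: (congr1 (fun t : NatTrans _ _ => t A) (@pcmp_assoc _ _ F x y z w h g f)).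
- move=> x y f; apply: tcell_ext => A.
  exact: (congr1 (fun t : NatTrans _ _ => t A) (@pcmp_lunit _ _ F x y f)).
- move=> x y f; apply: tcell_ext => A.
  exact: (congr1 (fun t : NatTrans _ _ => t A) (@pcmp_runit _ _ F x y f)).
- move=> x; have [e eu] := pnormal F x.
  exact: (@tan_normal (tobj_cat x) (tobj_strong (idm x)) (tobj_unit x) e eu).
Defined.

End TangentObjectPointwise.

(** * From tangent-valued pseudofunctors to tangent objects *)

Lemma ncomp_nat_fid (D : Category) (P : Functor D D) (b : NatTrans P (fid D))
  (A A' : D) (k : Hom A A') : b A' ∘ fmap P k = k ∘ b A.
Proof. exact: (ncomp_nat b). Qed.

(** * Fibre powers chosen objectwise as a functor *)

Section PowerFunctor.
Variables (D : Category) (T : Functor D D) (p : NatTrans T (fid D)) (n : nat).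
Variables (P : D -> D) (b : forall A, Hom (P A) A).
Variable q : forall A, 'I_n -> Hom (P A) (T A).
Hypothesis hP : forall A, is_fpower (p A) (b A) (q A).

Lemma power_map_ex (A A' : D) (k : Hom A A') : exists u : Hom (P A) (P A'),
  b A' ∘ u = k ∘ b A /\ forall i, q A' i ∘ u = fmap T k ∘ q A i.
Proof.
have [_ /(_ _ (k ∘ b A) (fun i => fmap T k ∘ q A i))[i|u [hu _]]] := hP A'.
  by rewrite cmpA ncomp_nat_fid cmp_assoc (proj1 (hP A)).
by exists u.
Qed.

Definition power_map (A A' : D) (k : Hom A A') : Hom (P A) (P A') :=
  sval (cid (power_map_ex k)).

Lemma power_map_b (A A' : D) (k : Hom A A') : b A' ∘ power_map k = k ∘ b A.
Proof. by rewrite /power_map; case: cid => ? []. Qed.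

Lemma power_map_q (A A' : D) (k : Hom A A') i :
  q A' i ∘ power_map k = fmap T k ∘ q A i.
Proof. by rewrite /power_map; case: cid => ? [? ->]. Qed.

Definition power_fun : Functor D D.
Proof.
refine {| fobj := P; fmap := power_map |}.
- move=> A; apply: (fpower_mono (hP A)) => [|i].
    by rewrite power_map_b cmp_idl cmp_idr.
  by rewrite power_map_q fmap_id cmp_idl cmp_idr.
- move=> A A' A'' k' k; apply: (fpower_mono (hP A'')) => [|i].
    by rewrite power_map_b cmpA power_map_b !cmp_assoc power_map_b.
  by rewrite power_map_q cmpA power_map_q !cmp_assoc power_map_q fmap_cmp cmp_assoc.
Defined.

Definition power_base : NatTrans power_fun (fid D) :=
  @Build_NatTrans _ _ power_fun (fid D) b power_map_b.

Definition power_proj (i : 'I_n) : NatTrans power_fun T :=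
  @Build_NatTrans _ _ power_fun T (fun A => q A i)
    (fun A A' k => power_map_q k i).

End PowerFunctor.

(** * Fibre powers as a pseudonatural transformation *)

Section PowerPseudoNat.
Variables (B : Category) (F : Pseudofunctor (LD B) CAT) (T : PseudoNat F F).
Variables (p : Modification T (pn_id F)) (n : nat).
Variable P : forall x, Functor (pcat F x) (pcat F x).
Variable b : forall x, NatTrans (P x) (fid (pcat F x)).
Variable q : forall x, 'I_n -> NatTrans (P x) (T x).
Hypothesis hP : forall x A, is_fpower (p x A) (b x A) (fun i => q x i A).
Hypothesis hpres : forall x y (f : Hom x y) A,
  is_fpower (fmap (pfun F f) (p x A)) (fmap (pfun F f) (b x A))
    (fun i => fmap (pfun F f) (q x i A)).

Let p_cell x y (f : Hom x y) A :
  p y (pfun F f A) ∘ pn_cell T f A = fmap (pfun F f) (p x A).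
Proof. by have := md_ax p f A; rewrite /= !cmp_idl. Qed.

Definition is_power_cell x y (f : Hom x y) A
    (u : Hom (pfun F f (P x A)) (P y (pfun F f A))) :=
  b y (pfun F f A) ∘ u = fmap (pfun F f) (b x A) /\
  forall i, q y i (pfun F f A) ∘ u = pn_cell T f A ∘ fmap (pfun F f) (q x i A).

Lemma power_cell_unique x y (f : Hom x y) A u v :
  @is_power_cell x y f A u -> is_power_cell v -> u = v.
Proof.
move=> [ub uq] [vb vq]; apply: (fpower_mono (hP (pfun F f A))) => [|i].
  by rewrite ub vb.
by rewrite uq vq.
Qed.

(** The image of the power at [A] is a power of the image of [p x A], hence, through the invertible
    cell of [T], of [p] at [pfun F f A]; two powers of one map are isomorphic over their
    projections. *)
Lemma power_cell_ex x y (f : Hom x y) A : exists u,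
  is_iso u /\ @is_power_cell x y f A u.
Proof.
have h := hpres f A.
have := iffLR (is_fpower_iso _ _ (pn_iso T f A) (p_cell f A)) h.
move=> /fpower_unique/(_ (hP (pfun F f A)))[u [ui ub uq]].
by exists u.
Qed.

Definition power_cell_at x y (f : Hom x y) A := sval (cid (power_cell_ex f A)).

Lemma power_cell_atP x y (f : Hom x y) A : is_power_cell (power_cell_at f A).
Proof. by rewrite /power_cell_at; case: cid => u []. Qed.

Lemma power_cell_iso x y (f : Hom x y) A : is_iso (power_cell_at f A).
Proof. by rewrite /power_cell_at; case: cid => u []. Qed.

Definition power_cell x y (f : Hom x y) :
  NatTrans (fcmp (pfun F f) (P x)) (fcmp (P y) (pfun F f)).
Proof.
refine (@Build_NatTrans _ _ (fcmp (pfun F f) (P x)) (fcmp (P y) (pfun F f))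
  (power_cell_at f) _).
move=> A A' k /=.
have [ub uq] := power_cell_atP f A; have [ub' uq'] := power_cell_atP f A'.
apply: (fpower_mono (hP (pfun F f A'))) => [|i].
  rewrite cmpA ub' -fmap_cmp ncomp_nat_fid cmpA ncomp_nat_fid.
  by rewrite cmp_assoc ub -fmap_cmp.
rewrite cmpA uq' cmp_assoc -fmap_cmp ncomp_nat fmap_cmp.
rewrite -(cmp_assoc _ (fmap (pfun F f) (fmap (T x) k))).
have := ncomp_nat (pn_cell T f) k; rewrite /= => ->.
rewrite cmpA ncomp_nat !cmp_assoc; congr (_ ∘ _); exact: (esym (uq i)).
Defined.

(** Both coherence laws are tested on the base map and the projections, where they follow from those
    of [T] and from naturality of the coherence cells of [F]. *)
Definition power_pn : PseudoNat F F.
Proof.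
refine (@Build_PseudoNat B F F P power_cell _ _ _).
- move=> x y f A; exact: power_cell_iso.
- move=> x y z g f A; rewrite /power_cell /=.
  have [ub uq] := power_cell_atP f A.
  have [vb vq] := power_cell_atP g (pfun F f A).
  have [wb wq] := power_cell_atP (g ∘ f) A.
  apply: (fpower_mono (hP (pfun F (g ∘ f) A))) => [|i]; rewrite !cmpA.
    rewrite wb ncomp_nat_fid.
    rewrite (cmp_assoc _ (b z _)) vb cmp_assoc -fmap_cmp ub.
    by have := ncomp_nat (pfun_cmp F g f) (b x A).
  rewrite wq (ncomp_nat (q z i)) /= cmp_assoc.
  have := ncomp_nat (pfun_cmp F g f) (q x i A); rewrite /= => <-.
  rewrite cmpA pn_cmp !cmp_assoc; congr (_ ∘ _).
  by rewrite (cmpA (q z i _)) vq !cmp_assoc -!fmap_cmp uq.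
- move=> x A; rewrite /power_cell /=.
  have [ub uq] := power_cell_atP (idm x) A.
  apply: (fpower_mono (hP (pfun F (idm x) A))) => [|i]; rewrite !cmpA.
    rewrite ub ncomp_nat_fid.
    by have := ncomp_nat (pfun_unit F x) (b x A).
  rewrite uq (ncomp_nat (q x i)) /= cmp_assoc.
  have := ncomp_nat (pfun_unit F x) (q x i A); rewrite /= => <-.
  by rewrite cmpA pn_unit.
Defined.

Definition power_md_base : Modification power_pn (pn_id F).
Proof.
refine (@Build_Modification B F F power_pn (pn_id F) b _).
by move=> x y f A; have [ub _] := power_cell_atP f A; rewrite /= !cmp_idl -ub.
Defined.

Definition power_md_proj (i : 'I_n) : Modification power_pn T.
Proof.
refine (@Build_Modification B F F power_pn T (fun x => q x i) _).
by move=> x y f A; have [_ /(_ i) uq] := power_cell_atP f A; rewrite -uq.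
Defined.

End PowerPseudoNat.

Lemma tcell_of_eq (D E : TangentCat) (H K : StrongMor D E) (e : H = K) :
  tcell (@cell_of_eq (StrongCat D E) H K e) =
  @cell_of_eq (FunCat D E) _ _ (congr1 (@sfun D E) e).
Proof. by case: K / e. Qed.

Section FromTangentValued.
Variables (B : Category) (G : Pseudofunctor (LD B) TAN).

Let gob (x : B) : TangentCat := pob G x.
Let gmap (x y : B) (f : Hom x y) : StrongMor (gob x) (gob y) := @pmap _ _ G x y f.
Let gmap2 (x y : B) (f g : Hom x y) (e : f = g) : TanCell (gmap f) (gmap g) :=
  @pmap2 _ _ G x y f g e.
Let gcmp (x y z : B) (g : Hom y z) (f : Hom x y) :
  TanCell (sm_cmp (gmap g) (gmap f)) (gmap (g ∘ f)) := @pcmp _ _ G x y z g f.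
Let gunit (x : B) : TanCell (sm_id (gob x)) (gmap (idm x)) := punit G x.

Let tcell_eq (D E : TangentCat) (H K : StrongMor D E) (r s : TanCell H K) :
  r = s -> tcell r = tcell s.
Proof. by move=> ->. Qed.

(** Built directly instead of as [pscmp Forget G], whose coherence cells carry identity factors:
    here they are literally those of [G], which lets [tobj_tanK] hold by computation. *)
Definition tv_psf : Pseudofunctor (LD B) CAT.
Proof.
refine (@Build_Pseudofunctor (LD B) CAT
  (fun x => tcat (gob x)) (fun x y f => sfun (gmap f))
  (fun x y f g e => tcell (gmap2 e)) (fun x y z g f => tcell (gcmp g f))
  (fun x => tcell (gunit x)) _ _ _ _ _ _ _ _ _).
- move=> x y f; exact: (tcell_eq (@pmap2_id _ _ G x y f)).
- move=> x y f g h b a; exact: (tcell_eq (@pmap2_cmp _ _ G x y _ _ _ b a)).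
- move=> x y z g f; have [s [s1 s2]] := @pcmp_iso _ _ G x y z g f.
  exists (tcell (s : TanCell _ _)).
  by split; [exact: (tcell_eq s1) | exact: (tcell_eq s2)].
- move=> x y z g f f' a; exact: (tcell_eq (@pcmp_lwhisk _ _ G x y z g _ _ a)).
- move=> x y z g g' b f; exact: (tcell_eq (@pcmp_rwhisk _ _ G x y z _ _ b f)).
- move=> x y z w h g f; exact: (tcell_eq (@pcmp_assoc _ _ G x y z w h g f)).
- move=> x y f; exact: (tcell_eq (@pcmp_lunit _ _ G x y f)).
- move=> x y f; exact: (tcell_eq (@pcmp_runit _ _ G x y f)).
- move=> x; have [e eu] := pnormal G x.
  exists (congr1 (@sfun _ _) e).
  exact: (etrans (tcell_eq eu) (tcell_of_eq e)).
Defined.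

Local Notation F := tv_psf.
Let ax (x : B) := tangent_ax (gob x).
Let sax (x y : B) (f : Hom x y) := strong_ax (gmap f).

Definition tv_T : PseudoNat F F.
Proof.
refine (@Build_PseudoNat B F F (fun x => tT (tdata (gob x)))
  (fun x y f => scell (gmap f)) _ _ _).
- move=> x y f A; exact: (strong_iso (sax f) A).
- move=> x y z g f A; exact: (esym (tcell_ax (gcmp g f) A)).
- move=> x A; have := tcell_ax (gunit x) A; rewrite /= !cmp_idl cmp_idr => e.
  exact: (esym e).
Defined.

Local Notation T := tv_T.

Definition tv_p : Modification T (pn_id F).
Proof.
refine (@Build_Modification B F F T (pn_id F) (fun x => tp (tdata (gob x))) _).
move=> x y f A; rewrite /= !cmp_idl; exact: (esym (strong_p (sax f) A)).
Defined.

Definition tv_zero : Modification (pn_id F) T.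
Proof.
refine (@Build_Modification B F F (pn_id F) T (fun x => tz (tdata (gob x))) _).
move=> x y f A; rewrite /= !cmp_idl cmp_idr; exact: (strong_zero (sax f) A).
Defined.

Let P2 (x : B) : Functor (pcat F x) (pcat F x) := tT2 (tdata (gob x)).
Let q2 (x : B) (i : 'I_2) : NatTrans (P2 x) (T x) :=
  if val i == 0 then tpi1 (tdata (gob x)) else tpi2 (tdata (gob x)).
Let b2 (x : B) : NatTrans (P2 x) (fid (pcat F x)) :=
  ncmp (tp (tdata (gob x))) (tpi1 (tdata (gob x))).

Let hP2 (x : B) (A : pcat F x) :
  is_fpower (tv_p x A) (b2 x A) (fun i => q2 x i A).
Proof.
have := fpower_two (tan_T2 (ax x) A 0); congr is_fpower.
by apply: functional_extensionality_dep => i; rewrite /two /q2; case: ifP.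
Qed.

Let hpres2 (x y : B) (f : Hom x y) (A : pcat F x) :
  is_fpower (fmap (pfun F f) (tv_p x A)) (fmap (pfun F f) (b2 x A))
    (fun i => fmap (pfun F f) (q2 x i A)).
Proof. exact: (strong_powers (sax f) (@hP2 x A)). Qed.

Definition tv_T2 : PseudoNat F F := power_pn hP2 hpres2.

Definition tv_pi1 : Modification tv_T2 T := power_md_proj hP2 hpres2 ord0.
Definition tv_pi2 : Modification tv_T2 T := power_md_proj hP2 hpres2 ord_max.

(** Identifies the map [alpha2] of [strong_add] with the cell of [tv_T2], making the addition a
    modification; it also recovers the original cell of [T2] in [tv_tobjK]. *)
Lemma tv_T2_cell (x y : B) (f : Hom x y) (A : pcat F x)
  (u : Hom (pfun F f (P2 x A)) (P2 y (pfun F f A))) :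
  pairs (tpi1 (tdata (gob y)) (pfun F f A)) (tpi2 (tdata (gob y)) (pfun F f A))
    (pn_cell T f A ∘ fmap (pfun F f) (tpi1 (tdata (gob x)) A))
    (pn_cell T f A ∘ fmap (pfun F f) (tpi2 (tdata (gob x)) A)) u ->
  pn_cell tv_T2 f A = u.
Proof.
move=> [u1 u2]; apply: (power_cell_unique hP2 (power_cell_atP hP2 hpres2 f A)).
split=> [|i].
  rewrite /= cmp_assoc u1 cmpA fmap_cmp; congr (_ ∘ _).
  exact: (strong_p (sax f) A).
by rewrite /q2; case: ifP.
Qed.

Definition tv_add : Modification tv_T2 T.
Proof.
refine (@Build_Modification B F F tv_T2 T (fun x => tadd (tdata (gob x))) _).
move=> x y f A; have [u [hu e]] := strong_add (sax f) A.
by rewrite (tv_T2_cell hu).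
Defined.

Definition tv_l : Modification T (pn_comp T T).
Proof.
refine (@Build_Modification B F F T (pn_comp T T)
  (fun x => tl (tdata (gob x))) _).
move=> x y f A; rewrite /= cmp_assoc; exact: (esym (strong_l (sax f) A)).
Defined.

Definition tv_c : Modification (pn_comp T T) (pn_comp T T).
Proof.
refine (@Build_Modification B F F (pn_comp T T) (pn_comp T T)
  (fun x => tc (tdata (gob x))) _).
move=> x y f A; rewrite /= cmp_assoc; exact: (esym (strong_c (sax f) A)).
Defined.

Definition tv_data : @TObjData (BICAT B) F := {|
  oT := T : @bhom (BICAT B) F F;
  opr := tv_p;
  oz := tv_zero;
  oT2 := tv_T2 : @bhom (BICAT B) F F;
  opi1 := tv_pi1;
  opi2 := tv_pi2;
  oadd := tv_add;
  ol := tv_l;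
  oc := tv_c |}.

Lemma tv_powers (n : nat) :
  exists (P : PseudoNat F F) (b : Modification P (pn_id F))
    (q : 'I_n -> Modification P T),
    forall (m : nat) (x : B) (A : pcat F x),
      is_fpower (fmap (fpow (T x) m) (tv_p x A)) (fmap (fpow (T x) m) (b x A))
        (fun i => fmap (fpow (T x) m) (q i x A)).
Proof.
(* Object, base map and projections are packed together so that one choice fixes a power along with
   its preservation by every iterate of [T]. *)
have h (x : B) (A : pcat F x) :
  {Pbq : {P : pcat F x & (Hom P A * ('I_n -> Hom P (T x A)))%type} |
    is_fpower (tv_p x A) (projT2 Pbq).1 (projT2 Pbq).2 /\
    forall m, is_fpower (fmap (fpow (T x) m) (tv_p x A))
      (fmap (fpow (T x) m) (projT2 Pbq).1)
      (fun i => fmap (fpow (T x) m) ((projT2 Pbq).2 i))}.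
  apply: cid; have [P [b [q hq]]] := tan_powers (ax x) A n.
  by exists (existT _ P (b, q)).
pose P x A := projT1 (sval (h x A)).
pose b x A : Hom (P x A) A := (projT2 (sval (h x A))).1.
pose q x A : 'I_n -> Hom (P x A) (T x A) := (projT2 (sval (h x A))).2.
have hP x A : is_fpower (tv_p x A) (b x A) (q x A).
  by have [] := svalP (h x A).
pose bb x : NatTrans (power_fun (hP x)) (fid (pcat F x)) := power_base (hP x).
pose qq x i : NatTrans (power_fun (hP x)) (T x) := power_proj (hP x) i.
have hPP x A : is_fpower (tv_p x A) (bb x A) (fun i => qq x i A) by exact: hP.
have hres x y (f : Hom x y) A : is_fpower (fmap (pfun F f) (tv_p x A))
    (fmap (pfun F f) (bb x A)) (fun i => fmap (pfun F f) (qq x i A)).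
  exact: (strong_powers (sax f) (hPP x A)).
exists (power_pn hPP hres), (power_md_base hPP hres), (power_md_proj hPP hres).
by move=> m x A; have [_ /(_ m)] := svalP (h x A).
Qed.

Let T2_at (x : B) (A : pcat F x) :
  is_pullback (tv_p x A) (tv_p x A) (tv_pi1 x A) (tv_pi2 x A).
Proof. exact: (tan_T2 (ax x) A 0). Qed.

Let T2_pullback : @is_pullback (PsNatCat F F) _ _ _ _ tv_p tv_p tv_pi1 tv_pi2.
Proof. by apply: pointwise_pullback => x A; exact: T2_at. Qed.

Let TT2_at (x : B) (A : pcat F x) :
  is_pullback (fmap (T x) (tv_p x A)) (fmap (T x) (tv_p x A))
    (fmap (T x) (tv_pi1 x A)) (fmap (T x) (tv_pi2 x A)).
Proof. exact: (tan_T2 (ax x) A 1). Qed.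

Let TT2_pullback : @is_pullback (PsNatCat F F) _ _ _ _ (md_lwhisk T tv_p)
  (md_lwhisk T tv_p) (md_lwhisk T tv_pi1) (md_lwhisk T tv_pi2).
Proof. by apply: pointwise_pullback => x A; exact: TT2_at. Qed.

Let T2T_pullback : @is_pullback (PsNatCat F F) _ _ _ _ (md_rwhisk tv_p T)
  (md_rwhisk tv_p T) (md_rwhisk tv_pi1 T) (md_rwhisk tv_pi2 T).
Proof. by apply: pointwise_pullback => x A; exact: T2_at. Qed.

Let at_eq (s t : PseudoNat F F) (m n : Modification s t) (x : B) (A : pcat F x) :
  m = n -> m x A = n x A.
Proof. by move=> ->. Qed.

Lemma tv_cmonoid : @is_cmonoid_over (PsNatCat F F) _ _ _ tv_p tv_pi1 tv_pi2
  tv_add tv_zero.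
Proof.
have padd : md_cmp tv_p tv_add = md_cmp tv_p tv_pi1.
  by apply: md_ext => x A; exact: (cmon_add_over (tan_cmonoid (ax x) A)).
have pz : md_cmp tv_p tv_zero = md_id (pn_id F).
  by apply: md_ext => x A; exact: (cmon_zero_over (tan_cmonoid (ax x) A)).
split=> //.
- have [|u [[u1 u2] _]] := proj2 T2_pullback T (md_cmp tv_zero tv_p) (md_id T).
    apply: md_ext => x A; rewrite /= cmpA cmp_idr.
    by rewrite (cmon_zero_over (tan_cmonoid (ax x) A)) cmp_idl.
  exists u; split=> //; apply: md_ext => x A.
  have [v [[v1 v2] e]] := cmon_unit (tan_cmonoid (ax x) A).
  apply: (etrans _ e); congr (_ ∘ _).
  apply: (pullback_mono (T2_at A)).
    exact: (etrans (at_eq A u1) (esym v1)).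
  exact: (etrans (at_eq A u2) (esym v2)).
- have [|u [[u1 u2] _]] := proj2 T2_pullback tv_T2 tv_pi2 tv_pi1.
    by have [-> _] := T2_pullback.
  exists u; split=> //; apply: md_ext => x A.
  have [v [[v1 v2] e]] := cmon_comm (tan_cmonoid (ax x) A).
  apply: (etrans _ e); congr (_ ∘ _).
  apply: (pullback_mono (T2_at A)).
    exact: (etrans (at_eq A u1) (esym v1)).
  exact: (etrans (at_eq A u2) (esym v2)).
(* [P] is an arbitrary triple power in the hom-category. Associativity is reduced to generalized
   elements, whose components at [A] are compared by means of a triple power in the fibre. *)
- move=> P b q hq; apply: (add_assoc_fpower T2_pullback padd _ hq).
  move=> Q a b' c s s' t t' [s1 s2] [s1' s2'] [t1 t2] [t1' t2'].
  apply: md_ext => x A.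
  have [R [r [k [hR _]]]] := tan_powers (ax x) A 3.
  have hm := cmon_assoc (tan_cmonoid (ax x) A) hR.
  apply: (add_assoc_universal (T2_at A) hR hm); split.
  + exact: (at_eq A s1).
  + exact: (at_eq A s2).
  + exact: (at_eq A s1').
  + exact: (at_eq A s2').
  + exact: (at_eq A t1).
  + exact: (at_eq A t2).
  + exact: (at_eq A t1').
  + exact: (at_eq A t2').
Qed.

Lemma tv_is_tangent_object : is_tangent_object tv_data.
Proof.
split=> /=.
- exact: T2_pullback.
- move=> m X' f; apply: pointwise_pullback => x A /=.
  by rewrite bpow_fpow; exact: (tan_T2 (ax x)).
- move=> n; have [P [b [q h]]] := tv_powers n.
  exists P, b, q; split.
    by apply: pointwise_fpower => x A; have := h 0 x A.
  by move=> m X' f; apply: pointwise_fpower => x A /=; rewrite bpow_fpow; exact: h.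
- exact: tv_cmonoid.
- apply: md_ext => x A; rewrite /= cmp_idl; exact: (tan_l_p (ax x) A).
- have [|u [[u1 u2] _]] := proj2 TT2_pullback tv_T2 (md_cmp tv_l tv_pi1)
    (md_cmp tv_l tv_pi2).
    apply: md_ext => x A; rewrite /= !cmpA (tan_l_p (ax x) A) !cmp_assoc.
    by have [-> _] := T2_at A.
  exists u; split=> //; apply: md_ext => x A.
  have [v [[v1 v2] e]] := tan_l_add (ax x) A.
  apply: (etrans e); congr (_ ∘ _); apply: esym.
  apply: (pullback_mono (TT2_at A)).
    exact: (etrans (at_eq A u1) (esym v1)).
  exact: (etrans (at_eq A u2) (esym v2)).
- apply: md_ext => x A; rewrite /= cmp_idr; exact: (tan_l_zero (ax x) A).
- apply: md_ext => x A; rewrite /= !cmp_idl; exact: (tan_c_p (ax x) A).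
- have [|u [[u1 u2] _]] := proj2 T2T_pullback (pn_comp T tv_T2)
    (md_cmp tv_c (md_lwhisk T tv_pi1)) (md_cmp tv_c (md_lwhisk T tv_pi2)).
    apply: md_ext => x A; rewrite /= !cmpA (tan_c_p (ax x) A).
    by have [e _] := TT2_at A.
  exists u; split=> //; apply: md_ext => x A.
  have [v [[v1 v2] e]] := tan_c_add (ax x) A.
  apply: (etrans e); congr (_ ∘ _); apply: esym.
  apply: (pullback_mono (@T2_at x (T x A))).
    exact: (etrans (at_eq A u1) (esym v1)).
  exact: (etrans (at_eq A u2) (esym v2)).
- apply: md_ext => x A; rewrite /= !cmp_idr; exact: (tan_c_zero (ax x) A).
- apply: md_ext => x A; exact: (tan_c_c (ax x) A).
- apply: md_ext => x A; exact: (tan_c_l (ax x) A).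
- apply: md_ext => x A; rewrite /= !cmp_idl; exact: (tan_l_l (ax x) A).
- apply: md_ext => x A; rewrite /= !cmp_idl !cmp_idr.
  exact: (tan_yang_baxter (ax x) A).
- apply: md_ext => x A; rewrite /= !cmp_idl !cmp_idr.
  exact: (tan_c_c_l (ax x) A).
- have [|u [[u1 u2] _]] := proj2 TT2_pullback tv_T2 (md_cmp tv_l tv_pi1)
    (md_cmp (md_cmp (md_rwhisk tv_zero T) (md_lunit_inv T)) tv_pi2).
    apply: md_ext => x A; rewrite /= cmp_idr !cmpA (tan_l_p (ax x) A).
    have := ncomp_nat (tv_zero x) (tv_p x A); rewrite /= => <-.
    by rewrite !cmp_assoc; have [-> _] := T2_at A.
  exists u; split=> //.
  have h (x : B) (A : pcat F x) : is_pullback (fmap (T x) (tv_p x A)) (tv_zero x A)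
      (fmap (T x) (tv_add x A) ∘ (u : Modification tv_T2 (pn_comp T tv_T2)) x A)
      (tv_p x A ∘ tv_pi1 x A).
    have [v [hv ev]] := tan_vlift (ax x) A.
    have eu : v = fmap (T x) (tv_add x A) ∘
        (u : Modification tv_T2 (pn_comp T tv_T2)) x A.
      (* The lift given at [A] by the tangent category is the component of the modification built
         from [u], so the equalizer property passes to the latter. *)
      apply: (vlift_unique (ax x) hv).
      exists ((u : Modification tv_T2 (pn_comp T tv_T2)) x A); split=> //.
      split; first exact: (at_eq A u1).
      by have := at_eq A u2; rewrite /= cmp_idr.
    rewrite -eu; apply/(vlift_pullback_equalizer (p := tv_p x A)
      (pT := tv_p x (T x A))).
    + exact: (cmon_zero_over (tan_cmonoid (ax x) A)).
    + exact: (ncomp_nat (tv_p x) (tv_p x A)).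
    split=> //; rewrite eu cmpA -fmap_cmp.
    rewrite (cmon_add_over (tan_cmonoid (ax x) A)) fmap_cmp cmp_assoc.
    rewrite [X in _ ∘ X](at_eq A u1) /= !cmpA; congr (_ ∘ _).
    exact: (tan_l_p (ax x) A).
  (* Precomposition with [f] merely evaluates at the objects [f x A], so both requirements are
     instances of [h]. *)
  by split; [|move=> X' f]; apply: pointwise_pullback => x A;
    rewrite /= cmp_idl; exact: h.
Qed.

Definition tv_tobj : TangentObject (BICAT B) :=
  Build_TangentObject tv_is_tangent_object.

End FromTangentValued.

(** * The correspondence is bijective *)

Local Ltac identify a b :=
  have e : a = b; [exact: Prop_irrelevance | subst b].

Section PseudofunctorData.
Variables (B K : Bicategory).

Record PsfData := {
  dob : B -> K;
  dmap : forall x y : B, bhom x y -> bhom (dob x) (dob y);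
  dmap2 : forall (x y : B) (f g : bhom x y), Hom f g -> Hom (dmap f) (dmap g);
  dcmp : forall (x y z : B) (g : bhom y z) (f : bhom x y),
    Hom (dmap g · dmap f) (dmap (g · f));
  dunit : forall x : B, Hom (bid (dob x)) (dmap (bid x)) }.

Definition psf_data (F : Pseudofunctor B K) : PsfData := {|
  dob := pob F;
  dmap := @pmap _ _ F;
  dmap2 := @pmap2 _ _ F;
  dcmp := @pcmp _ _ F;
  dunit := @punit _ _ F |}.

Definition psf_of (d : PsfData) :=
  @Build_Pseudofunctor B K (dob d) (dmap d) (dmap2 d) (dcmp d) (dunit d).

(** With the laws as separate arguments, an equality of data can be substituted although the types
    of the laws depend on it; only proofs of the same propositions remain. *)
Lemma psf_of_eq (d d' : PsfData) l1 l2 l3 l4 l5 l6 l7 l8 l9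
  l1' l2' l3' l4' l5' l6' l7' l8' l9' :
  d = d' -> @psf_of d l1 l2 l3 l4 l5 l6 l7 l8 l9 =
            @psf_of d' l1' l2' l3' l4' l5' l6' l7' l8' l9'.
Proof.
by move=> e; subst d'; congr Build_Pseudofunctor; exact: Prop_irrelevance.
Qed.

Lemma psf_data_inj (F F' : Pseudofunctor B K) : psf_data F = psf_data F' -> F = F'.
Proof.
exact: (@psf_of_eq (psf_data F) (psf_data F')
  (@pmap2_id _ _ F) (@pmap2_cmp _ _ F) (@pcmp_iso _ _ F) (@pcmp_lwhisk _ _ F)
  (@pcmp_rwhisk _ _ F) (@pcmp_assoc _ _ F) (@pcmp_lunit _ _ F)
  (@pcmp_runit _ _ F) (@pnormal _ _ F)
  (@pmap2_id _ _ F') (@pmap2_cmp _ _ F') (@pcmp_iso _ _ F') (@pcmp_lwhisk _ _ F')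
  (@pcmp_rwhisk _ _ F') (@pcmp_assoc _ _ F') (@pcmp_lunit _ _ F')
  (@pcmp_runit _ _ F') (@pnormal _ _ F')).
Qed.

End PseudofunctorData.

(* [TanRaw] and, below, [TobjRaw] are stripped of proofs, so that equalities of
   structures whose types mention proofs become equalities of data. *)
Section TangentValuedData.
Variable B : Category.

Record TanRaw := {
  rcat : B -> Category;
  rtan : forall x, TangentData (rcat x);
  rfun : forall x y : B, Hom x y -> Functor (rcat x) (rcat y);
  rcell : forall (x y : B) (f : Hom x y),
    NatTrans (fcmp (rfun f) (tT (rtan x))) (fcmp (tT (rtan y)) (rfun f));
  rmap2 : forall (x y : B) (f g : Hom x y), f = g -> NatTrans (rfun f) (rfun g);
  rcmp : forall (x y z : B) (g : Hom y z) (f : Hom x y),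
    NatTrans (fcmp (rfun g) (rfun f)) (rfun (g ∘ f));
  runt : forall x : B, NatTrans (fid (rcat x)) (rfun (idm x)) }.

Definition tan_raw (G : Pseudofunctor (LD B) TAN) : TanRaw := {|
  rcat := fun x => tcat (pob G x);
  rtan := fun x => tdata (pob G x);
  rfun := fun x y f => sfun (@pmap _ _ G x y f);
  rcell := fun x y f => scell (@pmap _ _ G x y f);
  rmap2 := fun x y f g e => tcell (@pmap2 _ _ G x y f g e);
  rcmp := fun x y z g f => tcell (@pcmp _ _ G x y z g f);
  runt := fun x => tcell (@punit _ _ G x) |}.

Section OfRaw.
Variables (r : TanRaw) (h : forall x : B, is_tangent (rtan r x)).

Let ob (x : B) : TangentCat := Build_TangentCat (h x).

Variable hs : forall (x y : B) (f : Hom x y),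
  is_strong (dD := rtan r x) (dE := rtan r y) (rcell r f).

Let mor (x y : B) (f : Hom x y) : StrongMor (ob x) (ob y) :=
  @Build_StrongMor (ob x) (ob y) _ _ (hs f).

Definition tan_of h2 hc hu := @Build_PsfData (LD B) TAN ob mor
  (fun x y f g e => @Build_TanCell _ _ (mor f) (mor g)
     (@rmap2 r x y f g e) (h2 x y f g e))
  (fun x y z g f => @Build_TanCell _ _ (sm_cmp (mor g) (mor f)) (mor (cmp g f))
     (@rcmp r x y z g f) (hc x y z g f))
  (fun x => @Build_TanCell _ _ (sm_id (ob x)) (mor (idm x)) (@runt r x) (hu x)).

End OfRaw.

Lemma tan_of_eq (r r' : TanRaw) h hs h2 hc hu h' hs' h2' hc' hu' :
  r = r' -> @tan_of r h hs h2 hc hu = @tan_of r' h' hs' h2' hc' hu'.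
Proof.
move=> e; subst r'.
(* Proofs are identified before those whose types mention them: the cell axioms are stated for
   morphisms that contain [h] and [hs]. *)
by identify h h'; identify hs hs'; identify h2 h2'; identify hc hc'; identify hu hu'.
Qed.

Lemma tan_raw_inj (G G' : Pseudofunctor (LD B) TAN) :
  tan_raw G = tan_raw G' -> G = G'.
Proof.
move=> e; apply: psf_data_inj.
exact: (@tan_of_eq (tan_raw G) (tan_raw G')
  (fun x => tangent_ax (pob G x)) (fun x y f => strong_ax (@pmap _ _ G x y f))
  (fun x y f g e => tcell_ax (@pmap2 _ _ G x y f g e))
  (fun x y z g f => tcell_ax (@pcmp _ _ G x y z g f))
  (fun x => tcell_ax (@punit _ _ G x))
  (fun x => tangent_ax (pob G' x)) (fun x y f => strong_ax (@pmap _ _ G' x y f))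
  (fun x y f g e => tcell_ax (@pmap2 _ _ G' x y f g e))
  (fun x y z g f => tcell_ax (@pcmp _ _ G' x y z g f))
  (fun x => tcell_ax (@punit _ _ G' x)) e).
Qed.

(** The raw structures are convertible: the chosen powers and the cell of [tv_T2] do not enter the
    data of [tobj_tan], and everything else is copied from [G]. *)
Lemma tobj_tanK (G : Pseudofunctor (LD B) TAN) : tobj_tan (tv_tobj G) = G.
Proof. exact: tan_raw_inj. Qed.

Lemma forget_tobj_tan (X : TangentObject (BICAT B)) :
  pscmp Forget (tobj_tan X) = tobj_psf X.
Proof.
apply: psf_data_inj; rewrite /psf_data.
have ec : @pcmp _ _ (pscmp Forget (tobj_tan X)) = @pcmp _ _ (tobj_psf X).
  apply: functional_extensionality_dep => x.
  apply: functional_extensionality_dep => y.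
  apply: functional_extensionality_dep => z.
  apply: functional_extensionality_dep => g.
  apply: functional_extensionality_dep => f.
  by apply: nat_ext => A; exact: cmp_idr.
have eu : @punit _ _ (pscmp Forget (tobj_tan X)) = @punit _ _ (tobj_psf X).
  apply: functional_extensionality_dep => x.
  by apply: nat_ext => A; exact: cmp_idr.
by rewrite ec eu.
Qed.

End TangentValuedData.

(** * Recovering a tangent object from its tangent-valued pseudofunctor *)

Section TangentObjectData.
Variable B : Category.

Record TobjRaw := {
  opsf : PsfData (LD B) CAT;
  opn : forall x, Functor (dob opsf x : Category) (dob opsf x : Category);
  ocell : forall (x y : B) (f : Hom x y),
    NatTrans (fcmp (dmap opsf f) (opn x)) (fcmp (opn y) (dmap opsf f));
  opn2 : forall x, Functor (dob opsf x : Category) (dob opsf x : Category);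
  ocell2 : forall (x y : B) (f : Hom x y),
    NatTrans (fcmp (dmap opsf f) (opn2 x)) (fcmp (opn2 y) (dmap opsf f));
  omp : forall x, NatTrans (opn x) (fid _);
  omz : forall x, NatTrans (fid _) (opn x);
  ompi1 : forall x, NatTrans (opn2 x) (opn x);
  ompi2 : forall x, NatTrans (opn2 x) (opn x);
  omadd : forall x, NatTrans (opn2 x) (opn x);
  oml : forall x, NatTrans (opn x) (fcmp (opn x) (opn x));
  omc : forall x, NatTrans (fcmp (opn x) (opn x)) (fcmp (opn x) (opn x)) }.

(** Isolates the cell of [T2] as a parameter, the one datum that the round trip rebuilds by
    choice. *)
Definition tobj_raw_with (X : TangentObject (BICAT B))
  (cell2 : forall (x y : B) (f : Hom x y), NatTrans
    (fcmp (pfun (tobj_psf X) f) (tobj_T2 X x))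
    (fcmp (tobj_T2 X y) (pfun (tobj_psf X) f))) : TobjRaw := {|
  opsf := psf_data (tobj_psf X);
  opn := pn (tobj_T X);
  ocell := @pn_cell _ _ _ (tobj_T X);
  opn2 := pn (tobj_T2 X);
  ocell2 := cell2;
  omp := fun x => tp (tobj_at X x);
  omz := fun x => tz (tobj_at X x);
  ompi1 := fun x => tpi1 (tobj_at X x);
  ompi2 := fun x => tpi2 (tobj_at X x);
  omadd := fun x => tadd (tobj_at X x);
  oml := fun x => tl (tobj_at X x);
  omc := fun x => tc (tobj_at X x) |}.

Definition tobj_raw (X : TangentObject (BICAT B)) : TobjRaw :=
  tobj_raw_with (@pn_cell _ _ _ (tobj_T2 X)).

Definition tobj_of (r : TobjRaw) l1 l2 l3 l4 l5 l6 l7 l8 l9 n1 n2 n3 k1 k2 k3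
    m1 m2 m3 m4 m5 m6 m7 ax : TangentObject (BICAT B) :=
  let F := @psf_of _ _ (opsf r) l1 l2 l3 l4 l5 l6 l7 l8 l9 in
  let T := @Build_PseudoNat B F F (opn r) (@ocell r) n1 n2 n3 in
  let T2 := @Build_PseudoNat B F F (opn2 r) (@ocell2 r) k1 k2 k3 in
  let TT := pn_comp T T in
  @Build_TangentObject (BICAT B) F (@Build_TObjData (BICAT B) F T
    (@Build_Modification B F F T (pn_id F) (omp r) m1)
    (@Build_Modification B F F (pn_id F) T (omz r) m2)
    T2
    (@Build_Modification B F F T2 T (ompi1 r) m3)
    (@Build_Modification B F F T2 T (ompi2 r) m4)
    (@Build_Modification B F F T2 T (omadd r) m5)
    (@Build_Modification B F F T TT (oml r) m6)
    (@Build_Modification B F F TT TT (omc r) m7)) ax.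

Lemma tobj_of_eq (r r' : TobjRaw)
  l1 l2 l3 l4 l5 l6 l7 l8 l9 n1 n2 n3 k1 k2 k3 m1 m2 m3 m4 m5 m6 m7 ax
  l1' l2' l3' l4' l5' l6' l7' l8' l9' n1' n2' n3' k1' k2' k3'
  m1' m2' m3' m4' m5' m6' m7' ax' :
  r = r' ->
  @tobj_of r l1 l2 l3 l4 l5 l6 l7 l8 l9 n1 n2 n3 k1 k2 k3
    m1 m2 m3 m4 m5 m6 m7 ax =
  @tobj_of r' l1' l2' l3' l4' l5' l6' l7' l8' l9' n1' n2' n3' k1' k2' k3'
    m1' m2' m3' m4' m5' m6' m7' ax'.
Proof.
move=> e; subst r'.
identify l1 l1'; identify l2 l2'; identify l3 l3'; identify l4 l4'.
identify l5 l5'; identify l6 l6'; identify l7 l7'; identify l8 l8'.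
identify l9 l9'; identify n1 n1'; identify n2 n2'; identify n3 n3'.
identify k1 k1'; identify k2 k2'; identify k3 k3'; identify m1 m1'.
identify m2 m2'; identify m3 m3'; identify m4 m4'; identify m5 m5'.
by identify m6 m6'; identify m7 m7'; identify ax ax'.
Qed.

Lemma tobj_raw_inj (X Y : TangentObject (BICAT B)) :
  tobj_raw X = tobj_raw Y -> X = Y.
Proof.
pose F (Z : TangentObject (BICAT B)) := tobj_psf Z.
pose D (Z : TangentObject (BICAT B)) := tobj_data Z.
move=> e.
exact: (@tobj_of_eq (tobj_raw X) (tobj_raw Y)
  (@pmap2_id _ _ (F X)) (@pmap2_cmp _ _ (F X)) (@pcmp_iso _ _ (F X))
  (@pcmp_lwhisk _ _ (F X)) (@pcmp_rwhisk _ _ (F X)) (@pcmp_assoc _ _ (F X))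
  (@pcmp_lunit _ _ (F X)) (@pcmp_runit _ _ (F X)) (@pnormal _ _ (F X))
  (@pn_iso _ _ _ (tobj_T X)) (@pn_cmp _ _ _ (tobj_T X)) (@pn_unit _ _ _ (tobj_T X))
  (@pn_iso _ _ _ (tobj_T2 X)) (@pn_cmp _ _ _ (tobj_T2 X))
  (@pn_unit _ _ _ (tobj_T2 X))
  (@md_ax _ _ _ _ _ (opr (D X))) (@md_ax _ _ _ _ _ (oz (D X)))
  (@md_ax _ _ _ _ _ (opi1 (D X))) (@md_ax _ _ _ _ _ (opi2 (D X)))
  (@md_ax _ _ _ _ _ (oadd (D X))) (@md_ax _ _ _ _ _ (ol (D X)))
  (@md_ax _ _ _ _ _ (oc (D X))) (tobj_ax X)
  (@pmap2_id _ _ (F Y)) (@pmap2_cmp _ _ (F Y)) (@pcmp_iso _ _ (F Y))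
  (@pcmp_lwhisk _ _ (F Y)) (@pcmp_rwhisk _ _ (F Y)) (@pcmp_assoc _ _ (F Y))
  (@pcmp_lunit _ _ (F Y)) (@pcmp_runit _ _ (F Y)) (@pnormal _ _ (F Y))
  (@pn_iso _ _ _ (tobj_T Y)) (@pn_cmp _ _ _ (tobj_T Y)) (@pn_unit _ _ _ (tobj_T Y))
  (@pn_iso _ _ _ (tobj_T2 Y)) (@pn_cmp _ _ _ (tobj_T2 Y))
  (@pn_unit _ _ _ (tobj_T2 Y))
  (@md_ax _ _ _ _ _ (opr (D Y))) (@md_ax _ _ _ _ _ (oz (D Y)))
  (@md_ax _ _ _ _ _ (opi1 (D Y))) (@md_ax _ _ _ _ _ (opi2 (D Y)))
  (@md_ax _ _ _ _ _ (oadd (D Y))) (@md_ax _ _ _ _ _ (ol (D Y)))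
  (@md_ax _ _ _ _ _ (oc (D Y))) (tobj_ax Y) e).
Qed.

Lemma tv_tobjK (X : TangentObject (BICAT B)) : tv_tobj (tobj_tan X) = X.
Proof.
apply: tobj_raw_inj.
(* The rebuilt cell is typed over [X] itself, which is possible because the functors of [T2] return
   unchanged. *)
pose c : forall (x y : B) (f : Hom x y), NatTrans
    (fcmp (pfun (tobj_psf X) f) (tobj_T2 X x))
    (fcmp (tobj_T2 X y) (pfun (tobj_psf X) f)) :=
  @pn_cell _ _ _ (tv_T2 (tobj_tan X)).
have -> : tobj_raw (tv_tobj (tobj_tan X)) = tobj_raw_with c by [].
rewrite /tobj_raw; congr tobj_raw_with.
apply: functional_extensionality_dep => x.
apply: functional_extensionality_dep => y.
apply: functional_extensionality_dep => f.
(* The original cell satisfies the characterization of the rebuilt one: these are the modification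
   axioms of the two projections of [X]. *)
apply: nat_ext => A; apply: (@tv_T2_cell B (tobj_tan X)); split.
  exact: (esym (md_ax (opi1 (tobj_data X) : Modification _ _) f A)).
exact: (esym (md_ax (opi2 (tobj_data X) : Modification _ _) f A)).
Qed.

End TangentObjectData.

Theorem theorem3p42 (C : Category) :
  exists Phi : TangentObject (BICAT (op C)) -> Pseudofunctor (LD (op C)) TAN,
    bijective Phi /\
    forall X : TangentObject (BICAT (op C)),
      pscmp Forget (Phi X) = tobj_psf X /\
      same_tangent_data X (Phi X).
Proof.
exists (@tobj_tan (op C)); split.
  by exists (@tv_tobj (op C)); [exact: tv_tobjK | exact: tobj_tanK].
(* The agreement of tangent data holds by computation, from the definitions of [tobj_cat] and
   [tobj_strong]. *)
by move=> X; split; first exact: forget_tobj_tan.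
Qed.
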